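(* Let $0<d<k$ be integers and fix $\epsilon>0$. Then for Lebesgue almost all linear maps $L:\mathbb{R}^d\to\mathbb{R}^{k-d}$ the following holds for the corresponding cubical cut and project sets. For every admissible internal space $F_\pi$ (with associated projection $\pi$) there is a constant $C>0$, depending on $L$, $\epsilon$ and $\pi$, such that for every regular $s\in\mathbb{R}^k$, with $Y=Y_s$, every $r>0$, every equivalence class $\mathcal{P}$ of $r$-patches of $Y$, every $y\in Y$ and every real $R\ge 1$, \[ |\xi_{\mathcal P}(y,R)-\xi_{\mathcal P}|\le C\cdot\frac{(\log R)^{k+\epsilon}}{R^d}. \]
   Context: Cut and project setting. Let $0<d<k$ be integers. A linear map $L:\mathbb{R}^d\to\mathbb{R}^{k-d}$ is identified with its matrix $(\alpha_{ij})\in\mathbb{R}^{d(k-d)}$, $L(x)_i=\sum_{j=1}^d\alpha_{ij}x_j$, and ''almost all $L$'' refers to Lebesgue measure on $\mathbb{R}^{d(k-d)}$. The physical space is $E=\{(x,L(x)) : x\in\mathbb{R}^d\}\subset\mathbb{R}^k$. Standing assumption: $E$ is totally irrational, i.e. $E+\mathbb{Z}^k$ is dense in $\mathbb{R}^k$. An admissible internal space is a linear subspace $F_\pi\subset\mathbb{R}^k$ complementary to $E$ such that the projection $\pi:\mathbb{R}^k\to E$ along $F_\pi$ is injective on $\mathbb{Z}^k$; $\pi^*$ denotes the projection onto $F_\pi$ along $E$. The cubical window is $\mathcal{W}_\pi=\pi^*(\{0\}^d\times[0,1]^{k-d})$ and the slice is $\mathcal{S}=\mathcal{W}_\pi+E$.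 For $s\in\mathbb{R}^k$ the cubical cut and project set is $Y_s=\pi(\mathcal{S}\cap(\mathbb{Z}^k+s))$. The point $s$ (and $Y_s$) is regular if $\partial\mathcal{S}\cap(\mathbb{Z}^k+s)=\emptyset$. For $y\in Y=Y_s$, $\tilde y$ denotes the unique element of $\mathbb{Z}^k+s$ with $\pi(\tilde y)=y$. Patches. For $r>0$ let $C(r)=\mathbb{Z}^k\cap([-r,r]^d\times\mathbb{R}^{k-d})$. The $r$-patch at $y\in Y$ is $P(y,r)=\{y'\in Y : \tilde y'-\tilde y\in C(r)\}$. Two $r$-patches $P(y_1,r),P(y_2,r)$ are equivalent if $P(y_1,r)-y_1=P(y_2,r)-y_2$; $\mathcal{P}(y,r)$ denotes the equivalence class of $P(y,r)$. Frequencies. For an equivalence class $\mathcal P$ of $r$-patches, $y\in Y$ and $R>0$, \[ \xi_{\mathcal P}(y,R)=\frac{\#\{y'\in Y : \mathcal{P}(y',r)=\mathcal{P},\ \tilde y'-\tilde y\in C(R)\}}{\#\{y'\in Y : \tilde y'-\tilde y\in C(R)\}}, \] and $\xi_{\mathcal P}=\lim_{R\to\infty}\xi_{\mathcal P}(y,R)$ (this limit exists and does not depend on $s$ or $y$).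
   Formalization: log R is replaced by log(max(2,R)): as printed the bound is 0 at R=1, which would force ξ_P(y,1)=ξ_P, false since ξ_P(y,1) is rational while ξ_P is irrational for some classes (e.g. d=1, k=2, r=1); for R≥2 the bound is unchanged. *)

(* Defs.v *)
From mathcomp Require Import all_boot all_order all_algebra finmap.
From mathcomp Require Import all_classical all_reals all_analysis.
Import Order.TTheory GRing.Theory Num.Theory.
Import numFieldNormedType.Exports.

Set Implicit Arguments.
Unset Strict Implicit.
Unset Printing Implicit Defensive.

Local Open Scope classical_set_scope.
Local Open Scope ring_scope.

Section LebesgueMatrix.
Context {R : realType} {p q : nat}.

Definition closed_box (a b : 'M[R]_(p, q)) : set 'M[R]_(p, q) :=
  [set A | forall i j, a i j <= A i j <= b i j].

Definition box_volume (a b : 'M[R]_(p, q)) : R :=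
  \prod_(i < p) \prod_(j < q) (b i j - a i j).

Definition box_cover (A : set 'M[R]_(p, q))
    (c : nat -> 'M[R]_(p, q) * 'M[R]_(p, q)) : Prop :=
  (forall n i j, (c n).1 i j <= (c n).2 i j) /\
  A `<=` \bigcup_n closed_box (c n).1 (c n).2.

(* Lebesgue outer measure on R^(p * q); MathComp-Analysis only provides
   Lebesgue measure on R. *)
Definition lebesgue_outer (A : set 'M[R]_(p, q)) : \bar R :=
  ereal_inf [set (\sum_(0 <= n <oo) (box_volume (c n).1 (c n).2)%:E)%E
            | c in box_cover A].

(* The Lebesgue null sets are the sets of outer measure 0, so the property
   is not required to be measurable. *)
Definition lebesgue_almost_all (P : 'M[R]_(p, q) -> Prop) : Prop :=
  lebesgue_outer [set A | ~ P A] = 0%E.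

End LebesgueMatrix.

Definition boundary {T : topologicalType} (A : set T) : set T :=
  closure A `\` interior A.

(* R^k is the type of row vectors of size d + m, with m = k - d; lsubmx and
   rsubmx are the projections to R^d and R^m. *)
Section CutAndProject.
Context {R : realType} {d m : nat}.
Local Notation Rk := 'rV[R]_(d + m).

Definition linmap_of (L : 'M[R]_(m, d)) (x : 'rV[R]_d) : 'rV[R]_m :=
  x *m L^T.

Definition physical (L : 'M[R]_(m, d)) : {vspace Rk} :=
  limg (linfun (fun x : 'rV[R]_d => row_mx x (linmap_of L x))).

Lemma linmap_ofE L (x : 'rV[R]_d) i :
  linmap_of L x 0 i = \sum_(j < d) L i j * x 0 j.
Proof. by rewrite mxE; apply: eq_bigr => j _; rewrite mxE mulrC. Qed.

Lemma physicalP L (v : Rk) :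
  reflect (exists x : 'rV[R]_d, v = row_mx x (linmap_of L x))
          (v \in physical L).
Proof.
have -> : physical L = limg (linfun (mulmxr (row_mx 1%:M L^T))).
  by congr (limg (linfun _)); apply/funext => x; rewrite /= mul_mx_row mulmx1.
apply: (iffP memv_imgP) => [[x _ ->]|[x ->]]; exists x; rewrite ?memvf //;
  by rewrite lfunE /= mul_mx_row mulmx1.
Qed.

Definition Zk : set Rk := [set x | forall j, x 0 j \is a Num.int].

Definition totally_irrational (L : 'M[R]_(m, d)) : Prop :=
  dense [set e + n | e in [set` physical L] & n in Zk].

Section Projection.
Variables (L : 'M[R]_(m, d)) (F : {vspace Rk}).

Definition cproj : Rk -> Rk := daddv_pi (physical L) F.

Definition cproj_star : Rk -> Rk := daddv_pi F (physical L).

Definition admissible : Prop :=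
  [/\ (physical L + F)%VS = fullv, (physical L :&: F)%VS = 0%VS
    & set_inj Zk cproj].

Definition window : set Rk :=
  cproj_star @` [set x : Rk | lsubmx x = 0 /\
                              forall j, 0 <= rsubmx x 0 j <= 1].

Definition slice : set Rk := [set w + e | w in window & e in [set` physical L]].

Definition Zk_shift (s : Rk) : set Rk := [set n + s | n in Zk].

Definition cps (s : Rk) : set Rk := cproj @` (slice `&` Zk_shift s).

Definition regular (s : Rk) : Prop := boundary slice `&` Zk_shift s = set0.

(* The default value of get is never used: for admissible F the lift is unique
   on cps s. *)
Definition lift_pt (s y : Rk) : Rk :=
  get [set x | Zk_shift s x /\ cproj x = y].

Definition Cbox (r : R) : set Rk :=
  [set x | Zk x /\ forall j, `|lsubmx x 0 j| <= r].

Definition patch (s : Rk) (r : R) (y : Rk) : set Rk :=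
  [set y' | cps s y' /\ Cbox r (lift_pt s y' - lift_pt s y)].

(* Two r-patches are equivalent when these sets are equal, so that the set
   serves as the equivalence class; it also makes sense of the same class
   occurring in cps s for different s. *)
Definition patch_class (s : Rk) (r : R) (y : Rk) : set Rk :=
  [set y' - y | y' in patch s r y].

Definition is_patch_class (s : Rk) (r : R) (P : set Rk) : Prop :=
  exists2 y, cps s y & P = patch_class s r y.

Definition ncard (A : set Rk) : nat := #|` fset_set A|.

Definition xi (s : Rk) (r : R) (P : set Rk) (y : Rk) (T : R) : R :=
  (ncard [set y' | [/\ cps s y', patch_class s r y' = P
                     & Cbox T (lift_pt s y' - lift_pt s y)]])%:R /
  (ncard [set y' | cps s y' /\ Cbox T (lift_pt s y' - lift_pt s y)])%:R.

Definition is_frequency (r : R) (P : set Rk) (x : R) : Prop :=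
  forall s y, regular s -> cps s y -> xi s r P y T @[T --> +oo] --> x.

End Projection.
End CutAndProject.

(* In an error term log T has to be kept away from 0 as T tends to 1, where
   frequencies have already nonzero error; it is ln T for 2 <= T. *)
Definition logb {R : realType} (T : R) : R := ln (Num.max 2 T).

(* Main.v *)
(** Adding the height coordinates identifies the internal space with R^m,
m = k - d, the window with the unit cube and Y_s, for regular s, with Z^d: the
point with first coordinates n has height frac (w - L n).  Two points have
equivalent r-patches if and only if, for every coordinate, their heights lie in
the same interval between consecutive points frac ((L a)_i), |a| <= r.  So the
acceptance domains are boxes and the frequency is the volume of the box; what
is needed is a bound, uniform over boxes and shifts, for the discrepancy of the
Z^d-rotation of the torus R^m/Z^m by L on cubes of side K.

For this, L is rounded to a matrix g over F_p, where p is a prime that exceeds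
K^(d+1) by a constant factor but is polynomial in K.  This changes counts by
O(1).  On F_p the indicator of an interval is a finite combination of
characters whose coefficient at h is at most 1/‖h‖, where ‖h‖ is the distance
of h to pZ, replaced by 1 at h = 0.  So the discrepancy is at most a constant
times S(g) = sum over h <> 0 of prod_i 1/‖h_i‖ times
prod_j min(K, p/‖(h g)_j‖).  For fixed h <> 0 the vector h g is equidistributed
when g varies, so S has mean O((log p)^k).  Markov's inequality
along K = 2^(2^(b j)) and Borel-Cantelli give the bound (log K)^(k + eps) for
almost all L; in between, the bound is monotone in K, and passing from one j to
the next only multiplies log K by 2^b. *)

Require Import Defs.
From mathcomp Require Import all_boot all_order all_algebra finmap.
From mathcomp Require Import all_classical all_reals all_analysis.
From mathcomp Require Import complex zify ring lra.
Import Order.TTheory GRing.Theory Num.Theory.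
Import numFieldNormedType.Exports.
Local Open Scope classical_set_scope.
Local Open Scope ring_scope.

Set Implicit Arguments.
Unset Strict Implicit.
Unset Printing Implicit Defensive.

(** * Primes between n and 16 n^2 *)

(** This bounds each term of Legendre's formula for the central binomial coefficient by 1. *)
Lemma double_divn_le m q : ((m.*2 %/ q) <= (m %/ q).*2.+1)%N.
Proof.
have [->|q0] := posnP q; first by rewrite !divn0.
rewrite -ltnS ltn_divLR //.
have := ltn_ceil m q0; have := leq_trunc_div m q; nia.
Qed.

(** By Legendre's formula the exponent of p is the sum over k of floor(2m/p^k) - 2 floor(m/p^k).
    Each term is at most 1 and vanishes once p^k > 2m, so the exponent is at most [t]. *)
Lemma expn_logn_central_binomial p m : prime p -> (0 < m)%N ->
  (p ^ logn p 'C(m.*2, m) <= m.*2)%N.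
Proof.
move=> pp m0; have p1 := prime_gt1 pp.
have b0 : (0 < 'C(m.*2, m))%N by rewrite bin_gt0; lia.
set t := trunc_log p m.*2.
suff lt : (logn p 'C(m.*2, m) <= t)%N.
  apply: (@leq_trans (p ^ t)); first by rewrite leq_exp2l.
  by apply: trunc_logP => //; lia.
have E := congr1 (logn p) (bin_fact (_ : (m <= m.*2)%N)).
have {E} := E ltac:(lia); rewrite (_ : (m.*2 - m = m)%N); last lia.
rewrite lognM ?muln_gt0 ?fact_gt0 // lognM ?fact_gt0 // !logn_fact //.
have -> : (\sum_(1 <= k < m.+1) m %/ p ^ k =
           \sum_(1 <= k < m.*2.+1) m %/ p ^ k)%N.
  rewrite (@big_cat_nat _ _ _ m.+1 1 m.*2.+1) /=; try lia.
  rewrite [X in (_ + X)%N]big_nat_cond [X in (_ + X)%N]big1 ?addn0 // => k.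
  rewrite andbT => /andP[mk _]; apply: divn_small.
  by apply: leq_trans (ltn_expl k p1); lia.
move=> E.
have : (\sum_(1 <= k < m.*2.+1) m.*2 %/ p ^ k <=
        \sum_(1 <= k < m.*2.+1) (m %/ p ^ k + m %/ p ^ k + (k <= t)))%N.
  rewrite big_nat_cond [leqRHS]big_nat_cond; apply: leq_sum => k.
  rewrite andbT => /andP[k1 km]; case: (leqP k t) => kt.
    by have := double_divn_le m (p ^ k); lia.
  rewrite [leqLHS]divn_small //; apply: leq_trans (trunc_log_ltn _ p1) _.
  by rewrite leq_exp2l.
rewrite !big_split /= -E.
have tm : (t <= m.*2)%N.
  have : (p ^ t <= m.*2)%N by apply: trunc_logP => //; lia.
  by have := ltn_expl t p1; lia.
have -> : (\sum_(1 <= k < m.*2.+1) (k <= t) = t)%N.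
  rewrite (@big_cat_nat _ _ _ t.+1 1 m.*2.+1) //=; try lia.
  rewrite big_nat_cond (eq_bigr (fun=> 1%N)); last by move=> k; rewrite andbT; lia.
  rewrite -big_nat_cond sum_nat_const_nat muln1.
  rewrite big_nat_cond big1 => [|k]; first lia.
  by rewrite andbT; lia.
lia.
Qed.

Lemma central_binomial_ge m : (2 ^ m <= 'C(m.*2, m))%N.
Proof.
elim: m => [|m IH]; first by rewrite bin0.
rewrite expnS doubleS binS (_ : 'C(m.*2.+1, m.+1) = 'C(m.*2.+1, m)); last first.
  by rewrite -bin_sub; [congr 'C(_, _)|]; lia.
rewrite addnn -mul2n leq_mul2l /=; apply: leq_trans IH _.
by case: m => // m; rewrite binS leq_addr.
Qed.

(* If every prime up to 2m were at most n, the central binomial coefficient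
   would be at most (2m)^n, although it is at least 2^m. *)
Lemma prime_between n : (0 < n)%N ->
  exists2 p, prime p & (n < p <= 16 * n ^ 2)%N.
Proof.
move=> n0; apply: contrapT => H.
set m := (8 * n ^ 2)%N.
have m0 : (0 < m)%N by rewrite /m; nia.
have mE : m.*2 = (16 * n ^ 2)%N by rewrite /m; lia.
have b0 : (0 < 'C(m.*2, m))%N by rewrite bin_gt0; lia.
have small p : p \in primes 'C(m.*2, m) -> (0 < p <= n)%N.
  rewrite mem_primes => /and3P[pp _ pd]; rewrite prime_gt0 //= leqNgt.
  apply/negP => np; apply: H; exists p => //; rewrite np -mE /=.
  have := expn_logn_central_binomial pp m0; apply: leq_trans.
  by rewrite -{1}(expn1 p) leq_exp2l ?prime_gt1 // logn_gt0 mem_primes pp b0.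
have : ('C(m.*2, m) <= m.*2 ^ n)%N.
  rewrite {1}(prod_prime_decomp b0) prime_decompE big_map /=.
  apply: (@leq_trans (\prod_(p <- primes 'C(m.*2, m)) m.*2)).
    rewrite !(big_seq _ _ (primes _)); apply: leq_prod => p.
    by rewrite mem_primes => /andP[pp _]; exact: expn_logn_central_binomial.
  rewrite big_const_seq count_predT iter_muln_1 leq_pexp2l; try lia.
  rewrite -(size_iota 1 n); apply: uniq_leq_size (primes_uniq _) _ => p /small.
  by rewrite mem_iota; lia.
(* Since 2^m = (2^(8n))^n, it is enough that 16 n^2 < 2^(8n). From n < 2^n one gets 16 n^2 < 2^(4 +
   2n). *)
apply/negP; rewrite -ltnNge; apply: leq_trans (central_binomial_ge m).
rewrite mE (_ : m = (8 * n * n)%N) ?(expnM 2 (8 * n)) ?ltn_exp2r //.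
  2: by rewrite /m; nia.
have l : (n < 2 ^ n)%N by exact: ltn_expl.
apply: (@leq_trans (2 ^ (4 + 2 * n))); last by rewrite leq_exp2l //; lia.
by rewrite expnD (mulnC 2) expnM; nia.
Qed.

(** * Characters of F_p *)

Section Characters.
Context {R : realType}.
Implicit Types (x y t : R) (z : R[i]).

Local Notation normc := ComplexField.Normc.normc.

(** The mean value theorem gives sin(y/2) >= (y/2) cos(y/2). Hence sin y = 2 sin(y/2) cos(y/2) >= y
    cos(y/2)^2, and 2 cos(y/2)^2 = 1 + cos y >= 1. *)
Lemma sin_ge_half y : 0 <= y <= pi / 2 -> y / 2 <= sin y.
Proof.
move=> /andP[y0 yp]; have p2 := pi_gt0 R.
have [->|yn0] := eqVneq y 0; first by rewrite sin0 mul0r.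
have z0 : 0 < y / 2 by rewrite divr_gt0 // lt_neqAle eq_sym yn0.
have cz : 0 < cos (y / 2) by rewrite cos_gt0_pihalf //; apply/andP; split; lra.
have szc : (y / 2) * cos (y / 2) <= sin (y / 2).
  have [|c] := @MVT _ sin cos 0 (y / 2) z0.
    by apply: continuous_subspaceT => c; exact: continuous_sin.
  rewrite in_itv /= subr0 sin0 subr0 => /andP[c0 cy] ->.
  rewrite mulrC ler_pM2r // ltW // ltr_cos // in_itv /=; apply/andP; split; lra.
have hy : (y / 2) *+ 2 = y by rewrite -(mulr_natr (y / 2)) divfK ?pnatr_eq0.
have c2 : 1 <= cos (y / 2) ^+ 2 *+ 2.
  rewrite -subr_ge0 -cos_mulr2n hy.
  by apply: cos_ge0_pihalf; apply/andP; split; lra.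
have -> : sin y = (cos (y / 2) * sin (y / 2)) *+ 2.
  by rewrite -sin_mulr2n hy.
nra.
Qed.

Lemma sum_inv_le_ln n : (0 < n)%N ->
  \sum_(1 <= k < n.+1) (k%:R^-1 : R) <= 1 + ln n%:R.
Proof.
elim: n => // -[|n] IH _; first by rewrite big_nat1 ln1 addr0 invr1.
rewrite big_nat_recr //=; apply: le_trans (lerD (IH isT) (lexx _)) _.
rewrite -addrA lerD2l -lerBrDl.
have n1 : 0 < n.+1%:R / n.+2%:R :> R by rewrite divr_gt0.
have := @le_ln1Dx R (n.+1%:R / n.+2%:R - 1).
rewrite (addrC 1) subrK lnM ?posrE ?invr_gt0 // lnV ?posrE // => H.
have E : n.+1%:R / n.+2%:R - 1 = - n.+2%:R^-1 :> R.
  have -> : n.+1%:R = n.+2%:R - 1 :> R by rewrite [n.+2%:R]mulrSr addrK.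
  by rewrite mulrBl mulfV ?pnatr_eq0 // mul1r addrAC subrr add0r.
rewrite E in H; have : - n.+2%:R^-1 > -1 :> R by rewrite -E ltrBrDr addNr.
by move=> /H; rewrite lerNr opprB.
Qed.

Lemma normc_real x : normc (x%:C)%C = `|x|.
Proof. by rewrite /= expr0n addr0 sqrtr_sqr. Qed.

Lemma normc_ge0 z : 0 <= normc z.
Proof. by case: z => a b; exact: sqrtr_ge0. Qed.

Lemma normc_sum (I : Type) (r : seq I) (P : pred I) (F : I -> R[i]) :
  normc (\sum_(i <- r | P i) F i) <= \sum_(i <- r | P i) normc (F i).
Proof.
elim/big_ind2: _ => [|a b c e H1 H2|//]; first by rewrite ComplexField.Normc.normc0.
exact: le_trans (le_normcD _ _) (lerD H1 H2).
Qed.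

Lemma normc_prod (I : Type) (r : seq I) (P : pred I) (F : I -> R[i]) :
  normc (\prod_(i <- r | P i) F i) = \prod_(i <- r | P i) normc (F i).
Proof.
exact: (big_morph _ (@ComplexField.Normc.normcM R) (@ComplexField.Normc.normc1 R)).
Qed.

Lemma normc_geometric z n : normc z = 1 -> z != 1 ->
  normc (\sum_(i < n) z ^+ i) <= 2 / normc (1 - z).
Proof.
move=> z1 zn1.
have n0 : 0 < normc (1 - z).
  rewrite lt_neqAle normc_ge0 andbT eq_sym; apply: contra zn1 => /eqP.
  by move/ComplexField.Normc.eq0_normc/eqP; rewrite subr_eq0 eq_sym.
rewrite ler_pdivlMr // mulrC -ComplexField.Normc.normcM.
rewrite -opprB mulNr -subrX1 opprB.
apply: le_trans (le_normcD _ _) _.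
rewrite ComplexField.Normc.normc1 normcN.
have -> : normc (z ^+ n) = 1.
  by rewrite -[n]card_ord -prodr_const normc_prod big1.
by [].
Qed.

Definition cis t : R[i] := (cos t +i* sin t)%C.

Lemma cisD s t : cis (s + t) = cis s * cis t.
Proof. by rewrite /cis sinD cosD; apply/eqP; rewrite eq_complex /= eqxx addrC mulrC eqxx. Qed.

Lemma normc_cis t : normc (cis t) = 1.
Proof. by rewrite /= cos2Dsin2 sqrtr1. Qed.

Lemma normc_1Bcis t : normc (1 - cis (t *+ 2)) = 2 * `|sin t|.
Proof.
rewrite -[2]ger0_norm // -normrM -sqrtr_sqr /=; congr Num.sqrt.
rewrite sub0r sqrrN cos_mulr2n sin_mulr2n cos2sin2 -mulrnAl !exprMn.
by rewrite -[X in X ^+ 2 * _]mulr_natl exprMn cos2sin2; ring.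
Qed.

Variables (p : nat) (pp : prime p).

Let p1 : (1 < p)%N := prime_gt1 pp.

Let p0R : 0 < p%:R :> R. Proof. by rewrite ltr0n prime_gt0. Qed.

(** The additive character e(a/p). The angle is kept as a double so that [normc_1Bcis] applies to
    it. *)
Definition char_Fp (a : 'F_p) : R[i] := cis ((pi * (a%:R / p%:R)) *+ 2).

Lemma ltn_Fp (a : 'F_p) : (a < p)%N.
Proof. by have := ltn_ord a; rewrite [X in (_ < X)%N](Fp_cast pp). Qed.

(** Periodicity makes [char_Fp] additive although it is defined through representatives below p. *)
Lemma cis_period (n : nat) :
  cis ((pi * (n%:R / p%:R)) *+ 2) = char_Fp n%:R.
Proof.
rewrite /char_Fp (val_Fp_nat pp).
have -> : n%:R / p%:R = (n %/ p)%:R + (n %% p)%:R / p%:R :> R.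
  by rewrite {1}(divn_eq n p) natrD natrM mulrDl mulfK // gt_eqF.
rewrite mulrDr mulrnDl cisD.
suff -> : cis ((pi * (n %/ p)%:R) *+ 2) = 1 by rewrite mul1r.
elim: (n %/ p)%N => [|k IH]; first by rewrite mulr0 mul0rn /cis cos0 sin0.
by rewrite (mulrS 1 k) mulrDr mulrnDl cisD IH mulr1 mulr1 /cis cos2pi sin2pi.
Qed.

Lemma char_FpD a b : char_Fp (a + b) = char_Fp a * char_Fp b.
Proof.
rewrite {2 3}/char_Fp -cisD -mulrnDl -mulrDr -mulrDl -natrD cis_period.
by rewrite natrD !natr_Zp.
Qed.

Lemma char_Fp0 : char_Fp 0 = 1.
Proof. by rewrite /char_Fp mul0r mulr0 mul0rn /cis cos0 sin0. Qed.

Lemma char_Fp_sum (I : Type) (r : seq I) (P : pred I) (F : I -> 'F_p) :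
  char_Fp (\sum_(i <- r | P i) F i) = \prod_(i <- r | P i) char_Fp (F i).
Proof. exact: (big_morph _ char_FpD char_Fp0). Qed.

Lemma char_FpMn a n : char_Fp (a *+ n) = char_Fp a ^+ n.
Proof.
by elim: n => [|n IH]; rewrite ?char_Fp0 // mulrS char_FpD IH exprS.
Qed.

Lemma normc_char a : normc (char_Fp a) = 1.
Proof. exact: normc_cis. Qed.

(* Up to a factor p this dominates the a-th Fourier coefficient of any
   interval; the value at a = 0 is junk. *)
Definition geom_bound (a : 'F_p) : R := 2 / normc (1 - char_Fp a).

(** Here |1 - e(a/p)| = 2 sin(pi a/p), and sin(pi a/p) >= min(a, p - a)/p by [sin_ge_half], pi >= 2
    and the symmetry of sin about pi/2. The larger of the two quotients is replaced by their sum,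
    which is easy to sum over a. *)
Lemma geom_bound_le (a : 'F_p) : a != 0 ->
  char_Fp a != 1 /\ geom_bound a <= p%:R / a%:R + p%:R / (p - a)%:R.
Proof.
move=> a0; have a1 : (0 < a)%N.
  by rewrite lt0n; apply: contra a0 => /eqP H; apply/eqP/val_inj.
have ap := ltn_Fp a.
have a0R : 0 < a%:R :> R by rewrite ltr0n.
have b0R : 0 < (p - a)%:R :> R by rewrite ltr0n subn_gt0.
have pip := pi_gt0 R; have pi2 : 2 <= pi :> R by exact: pi_ge2.
have bE : (p - a)%:R = p%:R - a%:R :> R by rewrite natrB // ltnW.
pose A : R := sin (pi * (a%:R / p%:R)).
have key (c : R) : 0 < c -> c / p%:R <= 1 / 2 ->
    c / p%:R <= sin (pi * (c / p%:R)).
  move=> c0 cp; have q0 : 0 < c / p%:R by rewrite divr_gt0.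
  have /sin_ge_half : 0 <= pi * (c / p%:R) <= pi / 2 by apply/andP; split; nra.
  by apply: le_trans; nra.
have aux (c : R) : 0 < c -> c / p%:R <= A ->
    0 < A /\ (A)^-1 <= p%:R / c.
  move=> c0 H; have q0 : 0 < c / p%:R by rewrite divr_gt0.
  have s0 := lt_le_trans q0 H; split => //.
  by rewrite -[p%:R / c]invf_div lef_pV2 // posrE.
have [s0 sle] : 0 < A /\
    (A)^-1 <= p%:R / a%:R + p%:R / (p - a)%:R.
  have q1 : 0 < p%:R / a%:R :> R by rewrite divr_gt0.
  have q2 : 0 < p%:R / (p - a)%:R :> R by rewrite divr_gt0.
  have [h|h] := leP (a%:R / p%:R) (1 / 2 : R).
    by have [s0 sle] := aux _ a0R (key _ a0R h); split => //; lra.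
  have E : (p - a)%:R / p%:R = 1 - a%:R / p%:R :> R.
    by rewrite bE mulrBl divff ?gt_eqF.
  have h' : (p - a)%:R / p%:R <= 1 / 2 :> R by rewrite E; lra.
  have := key _ b0R h'; rewrite {2}E mulrBr mulr1 sinB sinpi cospi mul0r sub0r.
  rewrite mulN1r opprK => /(aux _ b0R)[s0 sle].
  by split => //; lra.
have nE : normc (1 - char_Fp a) = 2 * A.
  by rewrite normc_1Bcis gtr0_norm.
split; last by rewrite /geom_bound nE invfM mulrA divff ?mul1r // pnatr_eq0.
apply/eqP => H; move: nE; rewrite H subrr ComplexField.Normc.normc0 => /eqP.
by rewrite eq_sym mulf_eq0 pnatr_eq0 /= gt_eqF.
Qed.

Lemma geom_bound_ge0 a : 0 <= geom_bound a.
Proof. by rewrite /geom_bound divr_ge0 // normc_ge0. Qed.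

(** Replacing h by h + 1 multiplies the sum by [char_Fp a], which differs from 1 if a is nonzero. *)
Lemma char_orthogonality (a : 'F_p) :
  \sum_(h : 'F_p) char_Fp (h * a) = if a == 0 then p%:R else 0.
Proof.
have [->|a0] := eqVneq a 0.
  rewrite (eq_bigr (fun=> 1)) => [|h _]; last by rewrite mulr0 char_Fp0.
  by rewrite sumr_const card_Fp.
have [c1 _] := geom_bound_le a0.
have : \sum_(h : 'F_p) char_Fp (h * a) = char_Fp a * \sum_(h : 'F_p) char_Fp (h * a).
  rewrite [LHS](reindex_inj (addIr 1)) mulr_sumr; apply: eq_bigr => h _ /=.
  by rewrite mulrDl mul1r char_FpD mulrC.
move/eqP; rewrite -[X in X == _]mul1r -subr_eq0 -mulrBl mulf_eq0 subr_eq0.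
by rewrite eq_sym (negPf c1) => /eqP.
Qed.

(** The h-th Fourier coefficient of the indicator of the residues 0, ..., l - 1. *)
Definition interval_coef (l : nat) (h : 'F_p) : R[i] :=
  p%:R^-1 * \sum_(u : 'F_p | (u < l)%N) char_Fp (- (h * u)).

Lemma interval_fourier l (x : 'F_p) :
  (x < l)%N%:R = \sum_(h : 'F_p) interval_coef l h * char_Fp (h * x).
Proof.
have pC : (p%:R : R[i]) != 0 by rewrite pnatr_eq0 -lt0n prime_gt0.
rewrite (eq_bigr (fun h => \sum_(u : 'F_p | (u < l)%N)
    p%:R^-1 * char_Fp (h * (x - u)))) => [|h _]; last first.
  rewrite /interval_coef mulr_sumr mulr_suml; apply: eq_bigr => u _.
  by rewrite -mulrA -char_FpD mulrBr addrC.
rewrite exchange_big /=.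
rewrite (eq_bigr (fun u => (x == u)%:R)) => [|u _]; last first.
  rewrite -mulr_sumr char_orthogonality subr_eq0.
  by case: eqVneq; rewrite ?mulVf // mulr0.
rewrite big_mkcond (bigD1 x) //= eqxx big1 ?addr0 => [|u /negPf ux].
  by case: ifP.
by rewrite eq_sym ux if_same.
Qed.

Lemma interval_coef0 l : (l <= p)%N -> interval_coef l 0 = ((l%:R / p%:R)%:C)%C.
Proof.
move=> lp; rewrite /interval_coef (eq_bigr (fun=> 1)) => [|u _].
  2: by rewrite mul0r oppr0 char_Fp0.
rewrite sumr_const rmorphM fmorphV !rmorph_nat mulrC; congr (_%:R / _).
rewrite -sum1_card (eq_bigl (fun u : 'F_p => (u < l)%N)) //.
rewrite -(big_mkord (fun u => (u < l)%N) (fun=> 1%N)).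
rewrite (_ : (Zp_trunc (pdiv p)).+2 = p); last exact: Fp_cast.
by rewrite -(big_nat_widen 0 l p predT) // sum_nat_const_nat muln1 subn0.
Qed.

Definition coef_bound (h : 'F_p) : R :=
  if h == 0 then 1 else geom_bound h / p%:R.

(** Bounds the geometric sum of the first K powers of [char_Fp (- h)]. Only the value at 0 depends
    on K. *)
Definition sum_bound (K : nat) (h : 'F_p) : R :=
  if h == 0 then K%:R else geom_bound h.

Lemma geom_boundN h : geom_bound (- h) = geom_bound h.
Proof.
rewrite /geom_bound; congr (2 / _).
have E : 1 - char_Fp (- h) = - (char_Fp (- h) * (1 - char_Fp h)).
  by rewrite mulrBr -char_FpD addNr char_Fp0 mulr1 opprB.
by rewrite E normcN ComplexField.Normc.normcM normc_char mul1r.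
Qed.

Lemma normc_geometric_char K h :
  normc (\sum_(i < K) char_Fp (- h) ^+ i) <= sum_bound K h.
Proof.
rewrite /sum_bound; case: eqVneq => [->|h0].
  rewrite oppr0 char_Fp0; apply: le_trans (normc_sum _ _ _) _.
  rewrite (eq_bigr (fun=> 1)) ?sumr_const ?card_ord // => i _.
  by rewrite expr1n ComplexField.Normc.normc1.
rewrite -geom_boundN; apply: normc_geometric; first exact: normc_char.
by have [] := @geom_bound_le (- h); rewrite ?oppr_eq0.
Qed.

Lemma interval_coef_le l h : (l <= p)%N ->
  normc (interval_coef l h) <= coef_bound h.
Proof.
move=> lp; rewrite /coef_bound; case: eqVneq => [->|h0].
  rewrite interval_coef0 // normc_real ger0_norm ?divr_ge0 //.
  by rewrite ler_pdivrMr ?mul1r ?ler_nat.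
rewrite /interval_coef ComplexField.Normc.normcM ComplexField.Normc.normcV.
have -> : normc (p%:R : R[i]) = p%:R.
  by rewrite -(rmorph_nat (real_complex R)) normc_real ger0_norm.
rewrite mulrC ler_pM2r ?invr_gt0 //.
have := normc_geometric_char l h; rewrite /sum_bound (negPf h0).
congr (normc _ <= _).
rewrite [RHS](eq_bigr (fun u : 'F_p => char_Fp (- h) ^+ u)) => [|u _]; last first.
  by rewrite -char_FpMn mulNrn -mulr_natr natr_Zp.
rewrite -(big_mkord (fun=> true) (fun i => char_Fp (- h) ^+ i)).
rewrite -(big_mkord (fun u => (u < l)%N) (fun i => char_Fp (- h) ^+ i)).
rewrite (_ : (Zp_trunc (pdiv p)).+2 = p); last exact: Fp_cast.
by rewrite -(big_nat_widen 0 l p predT) //.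
Qed.

End Characters.

(** * Discrepancy of rotations over F_p *)

Section FiniteDiscrepancy.
Context {R : realType}.
Variables (p : nat) (pp : prime p) (m d : nat).
Local Notation normc := ComplexField.Normc.normc.
Local Notation chi := (@char_Fp R p).

Let p0R : 0 < p%:R :> R. Proof. by rewrite ltr0n prime_gt0. Qed.

Definition row_comb (h : {ffun 'I_m -> 'F_p}) (g : 'M['F_p]_(m, d)) :
  {ffun 'I_d -> 'F_p} := [ffun j => \sum_(i < m) h i * g i j].

(* The bound for the contribution of the nonzero frequencies to the count of
   the orbit segment of length K of the rotation g in any box. *)
Definition fourier_bound (K : nat) (g : 'M['F_p]_(m, d)) : R :=
  \sum_(h : {ffun 'I_m -> 'F_p} | h != 0)
    (\prod_(i < m) coef_bound (h i)) *
    \prod_(j < d) sum_bound K (row_comb h g j).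

Definition Fp_point (g : 'M['F_p]_(m, d)) (t : 'I_m -> 'F_p) (n : 'I_d -> nat)
  (i : 'I_m) : 'F_p := t i - \sum_(j < d) g i j *+ n j.

Definition Fp_count (K : nat) g t (l : 'I_m -> nat) : nat :=
  #|[pred n : {ffun 'I_d -> 'I_K} |
      [forall i, (Fp_point g t (fun j => n j) i < l i)%N]]|.

(** After the m indicators are expanded and the sums exchanged, each frequency h carries an
    exponential sum over the cube, which factors into d geometric sums with ratios given by h g. *)
Lemma Fp_count_fourier K g t l :
  (Fp_count K g t l)%:R =
  \sum_(h : {ffun 'I_m -> 'F_p}) (\prod_(i < m) interval_coef (R := R) (l i) (h i)) *
    (\prod_(i < m) chi (h i * t i)) *
    \prod_(j < d) \sum_(a < K) chi (- row_comb h g j) ^+ a.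
Proof.
rewrite /Fp_count -sum1_card natr_sum.
pose u (n : {ffun 'I_d -> 'I_K}) i := Fp_point g t (fun j => n j) i.
transitivity (\sum_(n : {ffun 'I_d -> 'I_K})
    \prod_(i < m) ((u n i < l i)%N%:R : R[i])).
  rewrite big_mkcond; apply: eq_bigr => n _; rewrite inE.
  case: forallP => [H|/forallP]; first by rewrite big1 // => i _; rewrite /u H.
  rewrite negb_forall => /existsP[i /negPf Hi].
  by rewrite (bigD1 i) //= /u Hi mul0r.
under eq_bigr => n _ do
  (under eq_bigr => i _ do rewrite (interval_fourier (R := R) pp);
   rewrite bigA_distr_bigA /=).
rewrite exchange_big /=; apply: eq_bigr => h _.
rewrite bigA_distr_bigA mulr_sumr; apply: eq_bigr => n _.
rewrite big_split /= -mulrA; congr (_ * _).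
transitivity (\prod_(i < m) (chi (h i * t i) * \prod_(j < d) chi (- (h i * g i j)) ^+ n j)).
  apply: eq_bigr => i _; rewrite /u /Fp_point mulrBr (char_FpD pp); congr (_ * _).
  rewrite mulr_sumr -sumrN (char_Fp_sum pp); apply: eq_bigr => j _.
  by rewrite -(char_FpMn pp) mulrnAr mulNrn.
rewrite big_split /=; congr (_ * _); rewrite exchange_big /=.
apply: eq_bigr => j _; rewrite ffunE -sumrN (char_Fp_sum pp).
by rewrite -prodrXl.
Qed.

Lemma coef_bound_ge0 h : 0 <= coef_bound (R := R) (p := p) h.
Proof. by rewrite /coef_bound; case: ifP => // _; rewrite divr_ge0 ?geom_bound_ge0. Qed.

Lemma sum_bound_ge0 K h : 0 <= sum_bound (R := R) (p := p) K h.
Proof. by rewrite /sum_bound; case: ifP => // _; rewrite geom_bound_ge0. Qed.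

Lemma le_fourier_bound K K' g : (K <= K')%N ->
  fourier_bound K g <= fourier_bound K' g.
Proof.
move=> KK; apply: ler_sum => h _; apply: ler_wpM2l.
  by apply: prodr_ge0 => i _; exact: coef_bound_ge0.
apply: ler_prod => j _; rewrite sum_bound_ge0 /= /sum_bound.
by case: ifP => //; rewrite ler_nat.
Qed.

(** The frequency 0 gives exactly the main term. Bounding the other terms by absolute values removes
    t and l, so the estimate is uniform over shifts and boxes. *)
Lemma Fp_discrepancy K g t l : (forall i, (l i <= p)%N) ->
  `|(Fp_count K g t l)%:R - K%:R ^+ d * \prod_(i < m) ((l i)%:R / p%:R)|
    <= fourier_bound K g.
Proof.
move=> lp; rewrite -normc_real rmorphB rmorph_nat Fp_count_fourier.
rewrite (bigD1 (0 : {ffun 'I_m -> 'F_p})) //= addrAC.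
have -> : (\prod_(i < m) interval_coef (R := R) (l i) ((0 : {ffun 'I_m -> 'F_p}) i)) *
    (\prod_(i < m) chi ((0 : {ffun 'I_m -> 'F_p}) i * t i)) *
    (\prod_(j < d) \sum_(a < K) chi (- row_comb 0 g j) ^+ a) =
    (K%:R ^+ d * \prod_(i < m) ((l i)%:R / p%:R))%:C%C.
  rewrite rmorphM rmorphXn rmorph_nat rmorph_prod /= mulrC; congr (_ * _).
    rewrite (eq_bigr (fun=> K%:R)) ?prodr_const ?card_ord // => j _.
    rewrite (eq_bigr (fun=> 1)) ?sumr_const ?card_ord // => a _.
    rewrite ffunE big1 ?oppr0 ?char_Fp0 ?expr1n // => i _.
    by rewrite ffunE mul0r.
  rewrite [X in _ * X]big1 => [|i _]; last by rewrite ffunE mul0r char_Fp0.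
  by rewrite mulr1; apply: eq_bigr => i _; rewrite ffunE interval_coef0.
rewrite subrr add0r; apply: le_trans (normc_sum _ _ _) _.
apply: ler_sum => h _; rewrite !ComplexField.Normc.normcM !normc_prod.
rewrite [X in _ * X * _]big1 => [|i _]; last exact: normc_char.
rewrite mulr1; apply: ler_pM; try by apply: prodr_ge0 => i _; exact: normc_ge0.
  by apply: ler_prod => i _; rewrite normc_ge0 interval_coef_le.
by apply: ler_prod => i _; rewrite normc_ge0 normc_geometric_char.
Qed.

Lemma sum_geom_bound :
  \sum_(h : 'F_p | h != 0) geom_bound h <= 2 * p%:R * (1 + ln p%:R) :> R.
Proof.
have p1 := prime_gt1 pp.
apply: (@le_trans _ _ (\sum_(h : 'F_p | h != 0) (p%:R / h%:R + p%:R / (p - h)%:R))).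
  by apply: ler_sum => h h0; have [] := geom_bound_le (R := R) pp h0.
rewrite (eq_bigl (fun h : 'F_p => (0 < h)%N)) => [|h]; last first.
  by rewrite lt0n -val_eqE.
rewrite -(big_mkord (fun h => (0 < h)%N) (fun h => p%:R / h%:R + p%:R / (p - h)%:R : R)).
rewrite (_ : (Zp_trunc (pdiv p)).+2 = p); last exact: Fp_cast.
rewrite (@big_cat_nat _ _ _ 1 0 p) ?prime_gt0 //=; try lia.
rewrite big_mkcond big_nat1 /= add0r big_nat_cond (eq_bigl (fun h => (0 < h < p)%N && true)) => [|h].
  2: by rewrite andbT andbC andbA andbb.
rewrite -big_nat_cond big_split /= -2!mulr_sumr.
have -> : \sum_(1 <= h < p) ((p - h)%:R^-1 : R) = \sum_(1 <= h < p) h%:R^-1.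
  rewrite big_nat_rev /=; apply: eq_big_nat => h /andP[h1 hp].
  by rewrite add1n subSS subKn // ltnW.
have H : \sum_(1 <= h < p) (h%:R^-1 : R) <= 1 + ln p%:R.
  case: (p) p1 => // q q1; have q0 : (0 < q)%N by lia.
  apply: le_trans (sum_inv_le_ln q0) _.
  by rewrite lerD2l ler_ln ?posrE ?ltr0n // ?ler_nat; lia.
by have := ler_wpM2l (ltW p0R) H; lra.
Qed.

(** The leading 1 is the share of h = 0: exactly in [sum_coef_bound], and because K <= p in
    [sum_sum_bound]. *)
Definition log_bound : R := 1 + 2 * (1 + ln p%:R).

Lemma sum_coef_bound : \sum_(h : 'F_p) coef_bound h <= log_bound.
Proof.
rewrite (bigD1 0) //= {1}/coef_bound eqxx lerD2l.
rewrite (eq_bigr (fun h => geom_bound h / p%:R)) => [|h /negPf]; last first.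
  by rewrite /coef_bound => ->.
by rewrite -mulr_suml ler_pdivrMr // mulrAC; exact: sum_geom_bound.
Qed.

Lemma sum_sum_bound K : (K <= p)%N ->
  \sum_(h : 'F_p) sum_bound K h <= p%:R * log_bound.
Proof.
move=> Kp; rewrite (bigD1 0) //= {1}/sum_bound eqxx.
rewrite (eq_bigr (fun h => geom_bound h)) => [|h /negPf]; last first.
  by rewrite /sum_bound => ->.
rewrite mulrDr mulr1 lerD ?ler_nat // mulrCA mulrA; exact: sum_geom_bound.
Qed.

(** Equidistribution of h g. If h is nonzero at [i0], then adding w / h(i0) to row [i0] of g
    translates h g by w; averaging over all w gives the claim. *)
Lemma sum_row_comb (h : {ffun 'I_m -> 'F_p}) (f : {ffun 'I_d -> 'F_p} -> R) :
  h != 0 ->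
  p%:R ^+ d * (\sum_(g : 'M['F_p]_(m, d)) f (row_comb h g)) =
  p%:R ^+ (m * d) * \sum_(w : {ffun 'I_d -> 'F_p}) f w.
Proof.
move=> h0; have [i0 hi0] : exists i, h i != 0.
  apply/existsP; rewrite -negb_forall; apply: contra h0 => /forallP H.
  by apply/eqP/ffunP => i; rewrite ffunE; apply/eqP/H.
pose s (w : {ffun 'I_d -> 'F_p}) : 'M['F_p]_(m, d) :=
  \matrix_(i, j) (if i == i0 then (h i0)^-1 * w j else 0).
have sE w g : row_comb h (g + s w) = row_comb h g + w.
  apply/ffunP => j; rewrite !ffunE.
  under eq_bigr => i _ do rewrite !mxE mulrDr.
  rewrite big_split /=; congr (_ + _).
  rewrite (bigD1 i0) //= eqxx mulrA mulfV // mul1r big1 ?addr0 // => i /negPf ->.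
  by rewrite mulr0.
have cd : p%:R ^+ d = #|{: {ffun 'I_d -> 'F_p}}|%:R :> R.
  by rewrite card_ffun card_Fp // card_ord natrX.
have cmd : p%:R ^+ (m * d) = #|{: 'M['F_p]_(m, d)}|%:R :> R.
  by rewrite card_mx card_Fp // natrX.
rewrite cd mulr_natl -sumr_const.
transitivity (\sum_(w : {ffun 'I_d -> 'F_p}) \sum_(g : 'M['F_p]_(m, d)) f (row_comb h g + w)).
  apply: eq_bigr => w _; rewrite (reindex_inj (addIr (s w))) /=.
  by apply: eq_bigr => g _; rewrite sE.
rewrite exchange_big cmd mulr_natl -sumr_const /=; apply: eq_bigr => g _.
by rewrite [RHS](reindex_inj (addrI (row_comb h g))).
Qed.

Lemma log_bound_ge1 : 1 <= log_bound.
Proof. by rewrite lerDl mulr_ge0 // addr_ge0 // ln_ge0 // ler1n prime_gt0. Qed.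

(** For fixed h the mean over g factors, by [sum_row_comb], into d sums over F_p. The sum over h of
    the coefficients factors into m sums once the nonnegative term h = 0 is added. *)
Lemma sum_fourier_bound K : (K <= p)%N ->
  \sum_(g : 'M['F_p]_(m, d)) fourier_bound K g <=
  p%:R ^+ (m * d) * log_bound ^+ (d + m).
Proof.
move=> Kp; rewrite exchange_big /=.
have pd0 : 0 < p%:R ^+ d :> R by rewrite exprn_gt0.
have lb0 : 0 <= log_bound by apply: le_trans log_bound_ge1.
apply: (@le_trans _ _ (\sum_(h : {ffun 'I_m -> 'F_p} | h != 0)
   (\prod_(i < m) coef_bound (h i)) * (p%:R ^+ (m * d) * log_bound ^+ d))).
  apply: ler_sum => h h0; rewrite -mulr_sumr; apply: ler_wpM2l.
    by apply: prodr_ge0 => i _; exact: coef_bound_ge0.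
  rewrite -(ler_pM2l pd0).
  rewrite (sum_row_comb (fun w => \prod_(j < d) sum_bound K (w j))) //.
  rewrite mulrCA ler_pM2l ?exprn_gt0 // -exprMn.
  rewrite -(bigA_distr_bigA (fun (_ : 'I_d) w => sum_bound K w)) /= prodr_const card_ord.
  apply: lerXn2r; rewrite ?nnegrE ?mulr_ge0 ?sumr_ge0 ?sum_sum_bound //.
  by move=> w _; exact: sum_bound_ge0.
rewrite -mulr_suml mulrCA ler_pM2l ?exprn_gt0 // exprD mulrC ler_wpM2l ?exprn_ge0 //.
apply: (@le_trans _ _ (\sum_(h : {ffun 'I_m -> 'F_p}) \prod_(i < m) coef_bound (h i))).
  rewrite [leRHS](bigD1 (0 : {ffun 'I_m -> 'F_p})) //= lerDr; apply: prodr_ge0 => i _.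
  exact: coef_bound_ge0.
rewrite -(bigA_distr_bigA (fun (_ : 'I_m) w => coef_bound w)) /= prodr_const card_ord.
apply: lerXn2r; rewrite ?nnegrE ?sumr_ge0 ?sum_coef_bound //.
by move=> w _; exact: coef_bound_ge0.
Qed.

Lemma fourier_bound_ge0 K g : 0 <= fourier_bound K g.
Proof.
apply: sumr_ge0 => h _; apply: mulr_ge0; apply: prodr_ge0 => i _.
  exact: coef_bound_ge0.
exact: sum_bound_ge0.
Qed.

(** Markov's inequality for the counting measure on matrices. *)
Lemma card_fourier_bound_gt K (lam : R) : (K <= p)%N -> 0 < lam ->
  #|[pred g : 'M['F_p]_(m, d) | lam < fourier_bound K g]|%:R <=
  p%:R ^+ (m * d) * log_bound ^+ (d + m) / lam.
Proof.
move=> Kp lam0; rewrite ler_pdivlMr //; apply: le_trans (sum_fourier_bound Kp).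
rewrite mulr_natl -sumr_const; apply: (@le_trans _ _
    (\sum_(g in [pred g : 'M['F_p]_(m, d) | lam < fourier_bound K g]) fourier_bound K g)).
  by apply: ler_sum => g; rewrite inE => /ltW.
rewrite [leRHS](bigID (mem [pred g : 'M['F_p]_(m, d) | lam < fourier_bound K g])) /=.
by rewrite lerDl sumr_ge0 // => g _; exact: fourier_bound_ge0.
Qed.

End FiniteDiscrepancy.

(** * Rounding real rotations *)

Section Transfer.
Context {R : realType}.
Variables (m d : nat).
Implicit Types (L : 'M[R]_(m, d)) (sigma alpha beta : 'I_m -> R).

Definition frac (x : R) : R := x - (Num.floor x)%:~R.

Lemma floor_eqP (x : R) (z : int) : z%:~R <= x < (z + 1)%:~R -> Num.floor x = z.
Proof. by move/floor_def. Qed.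

Lemma frac_itvP (x a b : R) : 0 <= a -> b <= 1 ->
  reflect (exists z : int, z%:~R + a <= x < z%:~R + b) (a <= frac x < b).
Proof.
move=> a0 b1; apply: (iffP idP) => [/andP[ax xb]|[z /andP[ax xb]]].
  by exists (Num.floor x); rewrite addrC -lerBrDr ax -ltrBlDl.
have -> : frac x = x - z%:~R.
  by rewrite /frac (@floor_eqP x z) // intrD; apply/andP; split; lra.
by apply/andP; split; lra.
Qed.

Definition rot_point L sigma (n : 'I_d -> nat) (i : 'I_m) : R :=
  sigma i - \sum_(j < d) L i j * (n j)%:R.

Definition box_count L (K : nat) sigma alpha beta : nat :=
  #|[pred n : {ffun 'I_d -> 'I_K} | [forall i,
      alpha i <= frac (rot_point L sigma (fun j => n j) i) < beta i]]|.

Lemma ler_norm_prodB (I : Type) (r : seq I) (a b : I -> R) :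
  (forall i, 0 <= a i <= 1) -> (forall i, 0 <= b i <= 1) ->
  `|\prod_(i <- r) a i - \prod_(i <- r) b i| <= \sum_(i <- r) `|a i - b i|.
Proof.
move=> ha hb; elim: r => [|i r IH]; first by rewrite !big_nil subrr normr0.
rewrite !big_cons.
set A := \prod_(j <- r) a j in IH *; set B := \prod_(j <- r) b j in IH *.
have A01 : 0 <= A <= 1.
  apply/andP; split; first by apply: prodr_ge0 => j _; case/andP: (ha j).
  by apply: prodr_ile1 => j _; exact: ha.
have -> : a i * A - b i * B = (a i - b i) * A + b i * (A - B) by ring.
apply: le_trans (ler_normD _ _) _; rewrite !normrM.
have /andP[b0 b1] := hb i; case/andP: A01 => A0 A1.
rewrite (ger0_norm A0) (ger0_norm b0); apply: lerD; first by rewrite ler_piMr.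
by apply: le_trans IH; rewrite ler_piMl.
Qed.

Variables (p : nat) (pp : prime p).

Let p0R : 0 < p%:R :> R. Proof. by rewrite ltr0n prime_gt0. Qed.

(** Reduction modulo p loses nothing, since the rotation depends on L only modulo integers. *)
Definition round_mx L : 'M['F_p]_(m, d) :=
  \matrix_(i, j) (Num.floor (p%:R * L i j))%:~R.

Lemma Fp_intP (X : int) : exists z : int, X = z * p%:Z + ((X%:~R : 'F_p) : nat)%:Z.
Proof.
exists (X %/ p)%Z; rewrite {1}(divz_eq X p); congr (_ + _).
have p0 : (p%:Z != 0) by rewrite eqz_nat -lt0n prime_gt0.
have E : (X %% p)%Z = `|(X %% p)%Z|%N%:Z by rewrite gez0_abs // modz_ge0.
rewrite [in RHS](divz_eq X p) intrD intrM -pmulrn pchar_Fp_0 // mulr0 add0r.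
rewrite [in RHS]E -pmulrn (val_Fp_nat pp) modn_small // -ltz_nat -E.
by rewrite ltz_pmod // ltz_nat prime_gt0.
Qed.

Lemma Fp_val_int (z : int) (u : nat) :
  ((((z * p%:Z + u%:Z)%:~R : 'F_p) : nat) <= u)%N.
Proof.
rewrite intrD intrM -!pmulrn pchar_Fp_0 // mulr0 add0r (val_Fp_nat pp).
exact: leq_mod.
Qed.

(** An integer lift of [Fp_point] for the rounded data, comparable with p times [rot_point]. *)
Definition int_point L (A : 'I_m -> int) (n : 'I_d -> nat) (i : 'I_m) : int :=
  A i - \sum_(j < d) Num.floor (p%:R * L i j) * (n j)%:Z.

Lemma Fp_point_round L A n i :
  Fp_point (round_mx L) (fun i => (A i)%:~R) n i = (int_point L A n i)%:~R.
Proof.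
rewrite /Fp_point /int_point intrD; congr (_ + _).
rewrite mulrNz; congr (- _); rewrite (raddf_sum (intmul 1)) /=.
by apply: eq_bigr => j _; rewrite mxE intrM -pmulrn mulr_natr.
Qed.

(** Rounding sigma down costs less than 1, and rounding each of the d entries of row i costs at most
    n_j <= K. The two errors have opposite signs, hence the asymmetric interval. *)
Lemma int_point_approx L sigma (K : nat) (n : {ffun 'I_d -> 'I_K}) i :
  let X := int_point L (fun i => Num.floor (p%:R * sigma i)) (fun j => n j) i in
  (X%:~R - (d * K)%:R <= p%:R * rot_point L sigma (fun j => n j) i
     < X%:~R + 1).
Proof.
rewrite /= /int_point /rot_point intrD mulrNz (raddf_sum (intmul 1)) /=.
rewrite mulrBr mulr_sumr.
have S1 : \sum_(j < d) ((Num.floor (p%:R * L i j) * (n j)%:Z)%:~R : R) <=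
          \sum_(j < d) (p%:R * (L i j * (n j)%:R)).
  apply: ler_sum => j _; rewrite intrM mulrA ler_wpM2r //.
  by have /andP[] := floor_itv (p%:R * L i j).
have S2 : \sum_(j < d) (p%:R * (L i j * (n j)%:R)) <=
   \sum_(j < d) ((Num.floor (p%:R * L i j) * (n j)%:Z)%:~R : R) + (d * K)%:R.
  have -> : (d * K)%:R = \sum_(j < d) K%:R :> R.
    by rewrite sumr_const card_ord natrM mulr_natl.
  rewrite -big_split /=; apply: ler_sum => j _; rewrite intrM mulrA.
  have nK : ((n j)%:R <= K%:R :> R) by rewrite ler_nat ltnW.
  have := floor_itv (p%:R * L i j); rewrite intrD => /andP[f0 f1].
  apply: (@le_trans _ _ (((Num.floor (p%:R * L i j))%:~R + 1) * (n j)%:R)).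
    by rewrite ler_wpM2r // ltW.
  by rewrite mulrDl mul1r lerD2l.
have := floor_itv (p%:R * sigma i); rewrite intrD => /andP[f0 f1].
by apply/andP; split; lra.
Qed.

(** Subtracting alpha from sigma moves the corner of the box to 0. The rounding error is absorbed by
    lengthening the sides by d K, and cutting them off at p excludes no residue. *)
Lemma box_count_le L K sigma alpha beta :
  (forall i, 0 <= alpha i) -> (forall i, alpha i <= beta i) ->
  (forall i, beta i <= 1) ->
  (box_count L K sigma alpha beta <=
   Fp_count K (round_mx L) (fun i => (Num.floor (p%:R * (sigma i - alpha i)))%:~R)
     (fun i => minn p ((Num.truncn (p%:R * (beta i - alpha i))).+1 + d * K)))%N.
Proof.
move=> a0 ab b1; apply/subset_leq_card/fintype.subsetP => n; rewrite !inE.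
move=> /forallP H; apply/forallP => i.
have /frac_itvP-/(_ (a0 i) (b1 i))[z /andP[z1 z2]] := H i.
rewrite leq_min ltn_Fp // andTb.
rewrite (Fp_point_round L (fun i => Num.floor (p%:R * (sigma i - alpha i)))).
have /= := int_point_approx L (fun i => sigma i - alpha i) n i.
set X := int_point _ _ _ _.
have -> : rot_point L (fun i => sigma i - alpha i) (fun j => n j) i =
          rot_point L sigma (fun j => n j) i - alpha i by rewrite /rot_point addrAC.
set x := rot_point _ _ _ _ in z1 z2 * => /andP[x1 x2].
have pz1 : p%:R * z%:~R <= p%:R * (x - alpha i) by rewrite ler_pM2l //; lra.
have pz2 : p%:R * (x - alpha i) < p%:R * z%:~R + p%:R * (beta i - alpha i).
  by rewrite -mulrDr ltr_pM2l //; lra.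
have X0 : (z * p%:Z <= X)%R.
  rewrite -ltzD1 -(ltr_int R) intrD intrM -pmulrn mulrC; lra.
have XE : X = z * p%:Z + (absz (X - z * p%:Z)%R)%:Z.
  by rewrite gez0_abs ?subr_ge0 // addrC subrK.
rewrite XE; apply: leq_ltn_trans (Fp_val_int _ _) _.
rewrite -ltz_nat -(ltr_int R) gez0_abs ?subr_ge0 // intrD mulrNz intrM -!pmulrn.
have ba : 0 <= p%:R * (beta i - alpha i) by rewrite mulr_ge0 // subr_ge0.
have /andP[_] := truncn_itv ba.
by rewrite natrD; lra.
Qed.

(** Moving the starting point back by d K makes the lower rounding error harmless. The sides are
    shortened by d K + 1 to pay for this shift and for the rounding of sigma; a side shorter than
    that becomes 0. *)
Lemma box_count_ge L K sigma alpha beta :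
  (forall i, 0 <= alpha i) -> (forall i, alpha i <= beta i) ->
  (forall i, beta i <= 1) ->
  (Fp_count K (round_mx L)
     (fun i => (Num.floor (p%:R * (sigma i - alpha i)) - (d * K)%:Z)%:~R)
     (fun i => Num.truncn (p%:R * (beta i - alpha i)) - (d * K).+1) <=
   box_count L K sigma alpha beta)%N.
Proof.
move=> a0 ab b1; apply/subset_leq_card/fintype.subsetP => n; rewrite !inE.
move=> /forallP H; apply/forallP => i; apply/frac_itvP => //.
move: (H i).
rewrite (Fp_point_round L (fun i => Num.floor (p%:R * (sigma i - alpha i)) - (d * K)%:Z)).
have /= := int_point_approx L (fun i => sigma i - alpha i) n i.
have -> : rot_point L (fun i => sigma i - alpha i) (fun j => n j) i =
          rot_point L sigma (fun j => n j) i - alpha i by rewrite /rot_point addrAC.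
have -> : int_point L (fun i => Num.floor (p%:R * (sigma i - alpha i)) - (d * K)%:Z)
    (fun j => n j) i =
    int_point L (fun i => Num.floor (p%:R * (sigma i - alpha i))) (fun j => n j) i
      - (d * K)%:Z by rewrite /int_point addrAC.
set X := int_point _ _ _ _; set x := rot_point _ _ _ _ => /andP[x1 x2].
have [z XE] := Fp_intP (X - (d * K)%:Z).
move: XE; set u := nat_of_ord _ => XE ul.
have XR : X%:~R = z%:~R * p%:R + u%:R + (d * K)%:R :> R.
  by rewrite -[X](subrK (d * K)%:Z) XE !intrD intrM -!pmulrn.
have ba : 0 <= p%:R * (beta i - alpha i) by rewrite mulr_ge0 // subr_ge0.
have /andP[tr _] := truncn_itv ba.
have ul' : u%:R + (d * K)%:R + 2 <= p%:R * (beta i - alpha i).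
  apply: le_trans tr; rewrite -!natrD ler_nat; lia.
have u0 : 0 <= u%:R :> R by [].
exists z; apply/andP; split.
  suff : p%:R * z%:~R <= p%:R * (x - alpha i) by rewrite ler_pM2l //; lra.
  lra.
suff : p%:R * (x - alpha i) < p%:R * (z%:~R + (beta i - alpha i)).
  by rewrite ltr_pM2l //; lra.
rewrite mulrDr; lra.
Qed.

(** Each side of the two boxes over F_p differs from p (beta - alpha) by at most d K + 2. So the
    main terms differ by at most K^d m (d K + 2)/p, which the assumption on p bounds by m. *)
Lemma box_discrepancy L K sigma alpha beta :
  (forall i, 0 <= alpha i) -> (forall i, alpha i <= beta i) ->
  (forall i, beta i <= 1) -> (K ^ d * (d * K + 2) <= p)%N ->
  `|(box_count L K sigma alpha beta)%:R
     - K%:R ^+ d * \prod_(i < m) (beta i - alpha i)|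
   <= fourier_bound K (round_mx L) + m%:R.
Proof.
move=> a0 ab b1 Kp.
pose c i := beta i - alpha i.
have c01 i : 0 <= c i <= 1.
  by have := a0 i; have := ab i; have := b1 i; rewrite /c => *; apply/andP; split; lra.
have pc i : 0 <= p%:R * c i <= p%:R.
  by have /andP[? ?] := c01 i; rewrite mulr_ge0 //= ler_piMr.
have key (l : 'I_m -> nat) : (forall i, (l i <= p)%N) ->
    (forall i, `|(l i)%:R - p%:R * c i| <= (d * K + 2)%:R) ->
    `|K%:R ^+ d * \prod_(i < m) ((l i)%:R / p%:R) - K%:R ^+ d * \prod_(i < m) c i| <= m%:R.
  move=> lp lc; rewrite -mulrBr normrM ger0_norm ?exprn_ge0 //.
  have H : `|\prod_(i < m) ((l i)%:R / p%:R) - \prod_(i < m) c i| <=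
      \sum_(i < m) ((d * K + 2)%:R / p%:R).
    apply: le_trans (ler_norm_prodB _ _ c01) _ => [i|].
      by rewrite divr_ge0 //= ler_pdivrMr // mul1r ler_nat.
    apply: ler_sum => i _; rewrite ler_pdivlMr // -{2}(ger0_norm (ltW p0R)) -normrM.
    by rewrite mulrBl divfK ?gt_eqF // [c i * _]mulrC.
  apply: le_trans (ler_wpM2l (exprn_ge0 d (ler0n R K)) H) _.
  rewrite sumr_const card_ord -[X in _ * X]mulr_natl mulrCA ler_piMr // mulrA ler_pdivrMr // mul1r.
  by rewrite -natrX -natrM ler_nat.
pose lu i := minn p ((Num.truncn (p%:R * c i)).+1 + d * K).
pose ll i := (Num.truncn (p%:R * c i) - (d * K).+1)%N.
have lup i : (lu i <= p)%N by exact: geq_minl.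
have llp i : (ll i <= p)%N.
  have /andP[h0 h1] := pc i; have /andP[h2 _] := truncn_itv h0.
  apply: leq_trans (leq_subr _ _) _; rewrite -(ler_nat R); exact: le_trans h2 h1.
have luc i : `|(lu i)%:R - p%:R * c i| <= (d * K + 2)%:R.
  have /andP[h0 h1] := pc i; have /andP[h2] := truncn_itv h0.
  have dk : 0 <= (d * K)%:R :> R by [].
  rewrite -natr1 /lu natrD ler_norml => h3; case: leqP => H; last first.
    by rewrite natrD -natr1; apply/andP; split; lra.
  have : p%:R <= ((Num.truncn (p%:R * c i)).+1 + d * K)%:R :> R by rewrite ler_nat.
  by rewrite natrD -natr1 => H'; apply/andP; split; lra.
have llc i : `|(ll i)%:R - p%:R * c i| <= (d * K + 2)%:R.
  have /andP[h0 h1] := pc i; have /andP[h2] := truncn_itv h0.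
  have dk : 0 <= (d * K)%:R :> R by [].
  rewrite -natr1 /ll natrD ler_norml => h3.
  case: (leqP (d * K).+1 (Num.truncn (p%:R * c i))) => H.
    by rewrite natrB // -natr1; apply/andP; split; lra.
  have : (Num.truncn (p%:R * c i))%:R < (d * K).+1%:R :> R by rewrite ltr_nat.
  have -> : (Num.truncn (p%:R * c i) - (d * K).+1 = 0)%N by lia.
  by rewrite -natr1 => H'; apply/andP; split; lra.
have := box_count_ge L K sigma a0 ab b1; have := box_count_le L K sigma a0 ab b1.
rewrite -2!(ler_nat R).
have := Fp_discrepancy (R := R) pp K (round_mx L)
  (fun i => (Num.floor (p%:R * (sigma i - alpha i)) - (d * K)%:Z)%:~R) llp.
have := Fp_discrepancy (R := R) pp K (round_mx L)
  (fun i => (Num.floor (p%:R * (sigma i - alpha i)))%:~R) lup.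
have := key _ llp llc; have := key _ lup luc.
rewrite /lu /ll /c !ler_norml => /andP[? ?] /andP[? ?] /andP[? ?] /andP[? ?] ? ?.
by apply/andP; split; lra.
Qed.

End Transfer.

(** * Null sets of matrices *)

Lemma box_volume_ge0 (R : realType) (p q : nat) (a b : 'M[R]_(p, q)) :
  (forall i j, a i j <= b i j) -> 0 <= box_volume a b.
Proof.
by move=> H; apply: prodr_ge0 => i _; apply: prodr_ge0 => j _; rewrite subr_ge0.
Qed.

Lemma lebesgue_outer_ge0 (R : realType) (p q : nat) (A : set 'M[R]_(p, q)) :
  (0 <= lebesgue_outer A)%E.
Proof.
apply: le_ereal_inf_tmp => _ [c [c0 _] <-]; apply: nneseries_ge0 => n _ _.
by rewrite lee_fin box_volume_ge0.
Qed.

Lemma lebesgue_almost_all_imply (R : realType) (p q : nat)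
    (P Q : 'M[R]_(p, q) -> Prop) :
  (forall A, P A -> Q A) -> lebesgue_almost_all P -> lebesgue_almost_all Q.
Proof.
move=> PQ P0; apply/eqP; rewrite eq_le lebesgue_outer_ge0 andbT -P0.
apply: ereal_inf_le_tmp; apply: image_subset => c [c_le cov]; split=> //.
by move=> A QA; apply: cov => /PQ.
Qed.

Section OuterMeasure.
Context {R : realType}.
Variables (m d : nat).
Hypotheses (m_gt0 : (0 < m)%N) (d_gt0 : (0 < d)%N).
Local Notation box := ('M[R]_(m, d) * 'M[R]_(m, d))%type.

(** Covers by a sequence of finite lists are more convenient than covers by a sequence of boxes; the
    lists are concatenated into one sequence. *)
Lemma lebesgue_outer_eq0 (A : set 'M[R]_(m, d)) :
  (forall e : R, 0 < e -> exists cs : nat -> seq box,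
    [/\ forall k c, c \in cs k -> forall i j, c.1 i j <= c.2 i j,
        forall x, A x -> exists k, exists2 c, c \in cs k & closed_box c.1 c.2 x &
        forall n, \sum_(k < n) \sum_(c <- cs k) box_volume c.1 c.2 <= e]) ->
  lebesgue_outer A = 0%E.
Proof.
move=> H; apply/eqP; rewrite eq_le lebesgue_outer_ge0 andbT.
apply/lee_addgt0Pr => e e0; rewrite add0e.
have [cs [cs_le cs_cov cs_sum]] := H e e0.
(* A padding box in front of each list ensures that the first n lists have at least n entries even
   if some are empty. Its volume is 0 because m and d are positive. *)
pose box0 : box := (0, 0).
have v0 : box_volume box0.1 box0.2 = 0.
  rewrite /box_volume (bigD1 (Ordinal m_gt0)) //= (bigD1 (Ordinal d_gt0)) //=.
  by rewrite subrr !mul0r.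
pose F n := flatten [seq box0 :: cs k | k <- iota 0 n].
have FS n : F n.+1 = F n ++ box0 :: cs n.
  by rewrite /F -addn1 iotaD map_cat flatten_cat /= cats0.
have Fsz n : (n <= size (F n))%N.
  by elim: n => // n IH; rewrite FS size_cat /=; lia.
have Fpre n k : exists s, F (n + k)%N = F n ++ s.
  elim: k => [|k [s IH]]; first by exists [::]; rewrite addn0 cats0.
  by exists (s ++ box0 :: cs (n + k)%N); rewrite addnS FS IH -catA.
pose c n := nth box0 (F n.+1) n.
have cE n J : (n < size (F J))%N -> nth box0 (F J) n = c n.
  move=> nJ; rewrite /c; have [le|/ltnW le] := leqP n.+1 J.
    have [s Fs] := Fpre n.+1 (J - n.+1)%N.
    by move: Fs; rewrite subnKC // => ->; rewrite nth_cat (Fsz n.+1).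
  have [s Fs] := Fpre J (n.+1 - J)%N.
  by move: Fs; rewrite subnKC // => ->; rewrite nth_cat nJ.
have F_le J x : x \in F J -> forall i j, x.1 i j <= x.2 i j.
  move=> /flattenP[s /mapP[k _ ->]]; rewrite inE => /orP[/eqP -> i j|]; last exact: cs_le.
  by rewrite lexx.
have c_le n i j : (c n).1 i j <= (c n).2 i j.
  by apply: (F_le n.+1); apply: mem_nth.
have cov : box_cover A c.
  split=> // x /cs_cov[k [b bk xb]].
  have bF : b \in F k.+1 by rewrite FS mem_cat inE bk !orbT.
  exists (index b (F k.+1)) => //.
  by rewrite -(cE _ k.+1) ?index_mem // nth_index.
apply: (@le_trans _ _ (\sum_(0 <= n <oo) (box_volume (c n).1 (c n).2)%:E)%E).
  by apply: ereal_inf_lbound; exists c.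
apply: lime_le.
  by apply: is_cvg_nneseries => n _ _; rewrite lee_fin box_volume_ge0.
apply: nearW => J; rewrite sumEFin lee_fin; apply: le_trans (cs_sum J).
have -> : \sum_(k < J) \sum_(b <- cs k) box_volume b.1 b.2 =
    \sum_(b <- F J) box_volume b.1 b.2.
  elim: (J) => [|n IH]; first by rewrite big_ord0 big_nil.
  by rewrite big_ord_recr /= FS big_cat big_cons /= v0 add0r IH.
rewrite (big_nth box0) (@big_cat_nat _ _ _ J 0 (size (F J))) //=.
rewrite (eq_big_nat _ _ (F2 := fun n => box_volume (nth box0 (F J) n).1 (nth box0 (F J) n).2)).
  rewrite lerDl big_nat_cond sumr_ge0 // => n /andP[/andP[_ nJ] _].
  by apply: box_volume_ge0; apply: (F_le J); exact: mem_nth.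
by move=> n /andP[_ nJ]; rewrite cE // (leq_trans nJ).
Qed.

(** * Borel-Cantelli for the rounded matrices *)

Section BorelCantelli.
Variables (p K : nat -> nat) (lam : nat -> R) (C : R).
Hypotheses (pp : forall j, prime (p j)) (Kp : forall j, (K j <= p j)%N)
  (lam0 : forall j, 0 < lam j)
  (vol_le : forall j, (2 * j + 1)%:R ^+ (m * d) * (@log_bound R (p j) ^+ (d + m) / lam j)
            <= C / 2 ^+ j).

Let p0R j : 0 < (p j)%:R :> R. Proof. by rewrite ltr0n prime_gt0. Qed.

(** The lower corner of the cube of side 1/p of matrices with integer parts q - j and rounding g. *)
Definition cell_corner j (q : {ffun 'I_m * 'I_d -> 'I_(2 * j + 1)})
    (g : 'M['F_(p j)]_(m, d)) : 'M[R]_(m, d) :=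
  \matrix_(a, b) ((q (a, b))%:R - j%:R + (g a b)%:R / (p j)%:R).

Definition bad_cells j : seq box :=
  [seq (cell_corner qg.1 qg.2, cell_corner qg.1 qg.2 + const_mx (p j)%:R^-1)
  | qg in [pred qg : {ffun 'I_m * 'I_d -> 'I_(2 * j + 1)} * 'M['F_(p j)]_(m, d)
          | lam j < fourier_bound (R := R) (K j) qg.2]].

(** Every bad g occurs with (2j + 1)^(m d) integer parts, and each cell has volume p^(-m d), which
    cancels the factor p^(m d) in [card_fourier_bound_gt]. *)
Lemma bad_cells_volume j :
  \sum_(c <- bad_cells j) box_volume c.1 c.2 <= C / 2 ^+ j.
Proof.
rewrite big_image /=.
rewrite (eq_bigr (fun=> (p j)%:R^-1 ^+ (m * d))) => [|qg _]; last first.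
  rewrite /box_volume (eq_bigr (fun=> (p j)%:R^-1 ^+ d)) => [|a _].
    by rewrite prodr_const card_ord -exprM mulnC.
  rewrite (eq_bigr (fun=> (p j)%:R^-1)) ?prodr_const ?card_ord // => b _.
  by rewrite mxE [const_mx _ _ _]mxE addrAC subrr add0r.
rewrite sumr_const.
have -> : #|[pred qg : {ffun 'I_m * 'I_d -> 'I_(2 * j + 1)} * 'M['F_(p j)]_(m, d)
          | lam j < fourier_bound (R := R) (K j) qg.2]| =
  ((2 * j + 1) ^ (m * d) *
   #|[pred g : 'M['F_(p j)]_(m, d) | (lam j < fourier_bound (R := R) (K j) g)%R]|)%N.
  rewrite -[X in (X ^ _)%N]card_ord -[X in (_ ^ (X * _))%N]card_ord.
  rewrite -[X in (_ ^ (_ * X))%N]card_ord -card_prod -card_ffun -cardX.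
  by apply: eq_card => -[q g]; rewrite !inE.
rewrite -[leLHS]mulr_natl natrM natrX -mulrA; apply: le_trans (vol_le j).
apply: ler_wpM2l; first by rewrite exprn_ge0.
rewrite exprVn ler_pdivrMr ?exprn_gt0 //.
apply: le_trans (card_fourier_bound_gt (pp j) m d (Kp j) (lam0 j)) _.
by rewrite [leRHS]mulrC mulrA.
Qed.

Lemma mem_bad_cells j (L : 'M[R]_(m, d)) :
  (forall a b, `|L a b| <= j%:R) ->
  lam j < fourier_bound (R := R) (K j) (round_mx (p j) L) ->
  exists2 c, c \in bad_cells j & closed_box c.1 c.2 L.
Proof.
move=> Lj bad; set g := round_mx _ _ in bad.
have zP a b : exists q : 'I_(2 * j + 1),
    q%:R - j%:R + (g a b)%:R / (p j)%:R <= L a b <=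
    q%:R - j%:R + (g a b)%:R / (p j)%:R + (p j)%:R^-1.
  have [z zE] := Fp_intP (pp j) (Num.floor ((p j)%:R * L a b)).
  have gE : g a b = (Num.floor ((p j)%:R * L a b))%:~R by rewrite mxE.
  rewrite -gE in zE.
  have := floor_itv ((p j)%:R * L a b); rewrite intrD zE intrD intrM -!pmulrn.
  move=> /andP[f0 f1].
  have gp : (g a b)%:R + 1 <= (p j)%:R :> R.
    by rewrite natr1 ler_nat; exact: ltn_Fp.
  have {}f0 : z%:~R + (g a b)%:R / (p j)%:R <= L a b.
    by rewrite -(ler_pM2l (p0R j)) mulrDr mulrCA divff ?gt_eqF // mulr1 mulrC.
  have {}f1 : L a b < z%:~R + (g a b)%:R / (p j)%:R + (p j)%:R^-1.
    rewrite -(ltr_pM2l (p0R j)) !mulrDr mulrCA divff ?gt_eqF // mulr1.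
    by rewrite [_ * z%:~R]mulrC.
  have q0 : 0 <= (g a b)%:R / (p j)%:R :> R by rewrite divr_ge0.
  have q1 : (g a b)%:R / (p j)%:R + (p j)%:R^-1 <= 1 :> R.
    by rewrite -{2}[_^-1]mul1r -mulrDl ler_pdivrMr // mul1r.
  have := Lj a b; rewrite ler_norml => /andP[l0 l1].
  have z1 : z <= j%:Z by rewrite -(ler_int R) -pmulrn; lra.
  have z0 : - j%:Z <= z.
    by rewrite -ltzD1 -(ltr_int R) intrD mulrNz -pmulrn; lra.
  have zj : (absz (z + j%:Z)%R < 2 * j + 1)%N by lia.
  exists (Ordinal zj) => /=.
  have -> : (absz (z + j%:Z)%R)%:R = z%:~R + j%:R :> R.
    by rewrite pmulrn gez0_abs ?intrD -?pmulrn //; lia.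
  by rewrite addrK f0 ltW.
clearbody g; pose q := [ffun ab : 'I_m * 'I_d => xchoose (zP ab.1 ab.2)].
exists (cell_corner q g, cell_corner q g + const_mx (p j)%:R^-1).
  by apply/fintype.imageP; exists (q, g).
by move=> a b /=; rewrite !mxE ffunE; exact: (xchooseP (zP a b)).
Qed.

(** The cells of index j cover the bad matrices with entries at most j in absolute value. So a
    matrix that is bad for infinitely many j lies in cells of arbitrarily large index, and the cells
    from [J0] on have total volume at most 2 C / 2^J0 <= e. *)
Lemma eventually_fourier_bound_le : lebesgue_almost_all (fun L : 'M[R]_(m, d) =>
  exists J, forall j, (J <= j)%N ->
    fourier_bound (K j) (round_mx (p j) L) <= lam j).
Proof.
apply: lebesgue_outer_eq0 => e e0.
have C0 : 0 <= C.
  have := vol_le 0; rewrite expr0 divr1; apply: le_trans.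
  apply: mulr_ge0; first exact: exprn_ge0.
  apply: divr_ge0; last exact: ltW.
  by apply: exprn_ge0; apply: le_trans (log_bound_ge1 (pp 0)).
have [J0 HJ] : exists J0 : nat, 2 * C / e <= 2 ^+ J0.
  have Ce : 0 <= 2 * C / e by rewrite divr_ge0 ?mulr_ge0 // ltW.
  exists (Num.truncn (2 * C / e)).+1.
  have /andP[_ /ltW H] := truncn_itv Ce; apply: le_trans H _.
  by rewrite -natrX ler_nat ltnW // ltn_expl.
exists (fun k => bad_cells (J0 + k)); split=> [k c /fintype.imageP[qg _ ->] a b|L bad|n].
- by rewrite /= !mxE lerDl invr_ge0.
- have [J1 LJ1] : exists J1 : nat, forall a b, `|L a b| <= J1%:R.
    exists (\max_(ab : 'I_m * 'I_d) (Num.truncn `|L ab.1 ab.2|).+1)%N => a b.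
    have /andP[_ /ltW H] := truncn_itv (normr_ge0 (L a b)); apply: le_trans H _.
    rewrite ler_nat; exact: (leq_bigmax (a, b)).
  apply: contrapT => H; apply: bad; exists (J0 + J1)%N => j Jj.
  rewrite leNgt; apply/negP => bad; apply: H; exists (j - J0)%N.
  rewrite subnKC; last by lia.
  apply: mem_bad_cells => // a b; apply: le_trans (LJ1 a b) _.
  by rewrite ler_nat; lia.
apply: (@le_trans _ _ (\sum_(k < n) C / 2 ^+ (J0 + k))).
  by apply: ler_sum => k _; exact: bad_cells_volume.
have S : \sum_(k < n) C / 2 ^+ (J0 + k) = 2 * C / 2 ^+ J0 - 2 * C / 2 ^+ (J0 + n).
  elim: n => [|n IH]; first by rewrite big_ord0 addn0 subrr.
  rewrite big_ord_recr /= IH addnS exprS invfM mulrACA divff ?mul1r //.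
  by lra.
rewrite S lerBlDr; apply: (@le_trans _ _ e).
  by rewrite ler_pdivrMr ?exprn_gt0 // [leRHS]mulrC -ler_pdivrMr.
by rewrite lerDl divr_ge0 ?mulr_ge0 ?exprn_ge0.
Qed.

End BorelCantelli.
End OuterMeasure.

(** * Discrepancy for almost all L *)

Section MetricDiscrepancy.
Context {R : realType}.
Variables (m d : nat).
Hypotheses (m_gt0 : (0 < m)%N) (d_gt0 : (0 < d)%N).

(** This serves the finitely many scales at which [fourier_bound] is not yet controlled. *)
Lemma box_count_trivial (L : 'M[R]_(m, d)) K sigma alpha beta :
  (forall i, 0 <= alpha i) -> (forall i, alpha i <= beta i) ->
  (forall i, beta i <= 1) ->
  `|(box_count L K sigma alpha beta)%:R
    - K%:R ^+ d * \prod_(i < m) (beta i - alpha i)| <= K%:R ^+ d.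
Proof.
move=> a0 ab b1; set P := \prod_(i < m) _.
have P01 : 0 <= P <= 1.
  apply/andP; split; first by apply: prodr_ge0 => i _; rewrite subr_ge0.
  apply: prodr_ile1 => i _; rewrite subr_ge0 ab /=.
  by have := a0 i; have := b1 i; lra.
have cK : (box_count L K sigma alpha beta)%:R <= K%:R ^+ d :> R.
  rewrite -natrX ler_nat -[K in leqRHS]card_ord -[d in leqRHS]card_ord -card_ffun.
  exact: max_card.
have c0 : 0 <= (box_count L K sigma alpha beta)%:R :> R by [].
have Kd : 0 <= K%:R ^+ d :> R by rewrite exprn_ge0.
case/andP: P01 => P0 P1.
have Kd1 : K%:R ^+ d * P <= K%:R ^+ d by rewrite ler_piMr.
have Kd0 : 0 <= K%:R ^+ d * P by rewrite mulr_ge0.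
by rewrite ler_norml; apply/andP; split; lra.
Qed.

Lemma logb_ge (T : R) : ln 2 <= logb T.
Proof. by rewrite /logb ler_ln ?posrE ?lt_max ?ltr0n // le_max lexx. Qed.

Lemma ln2_gt0 : 0 < ln 2 :> R.
Proof. by rewrite ln_gt0 // ltr1n. Qed.

Lemma ln2_le1 : ln 2 <= 1 :> R.
Proof. by have := @le_ln1Dx R 1; rewrite -[1 + 1]/(2 : R); apply; lra. Qed.

(** The factor 3 in K <= 3 T fits cubes of side 2 floor(T) + 1. Since ln 3 <= 2 ln 2, one has ln K
    <= 3 [logb T], which is at most v ln 2. *)
Lemma le_nat_of_logb (T : R) (K v : nat) : 1 <= T -> K%:R <= 3 * T ->
  3 * (logb T / ln 2) <= v%:R -> (K <= 2 ^ v)%N.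
Proof.
move=> T1 KT Hv; have l2 := ln2_gt0.
have [->//|K0] := posnP K.
rewrite -(ler_nat R) natrX -ler_ln ?posrE ?ltr0n ?exprn_gt0 // lnXn ?ltr0n //.
rewrite -[leRHS]mulr_natl.
have T0 : 0 < T by lra.
have h1 : ln K%:R <= ln (3 * T).
  by rewrite ler_ln ?posrE ?ltr0n // mulr_gt0.
have h2 : ln (3 * T) = ln 3 + ln T :> R by rewrite lnM ?posrE.
have h3 : ln 3 <= 2 * ln 2 :> R.
  have -> : 2 * ln 2 = ln 4 :> R.
    by rewrite (_ : 4 = 2 ^+ 2 :> R) ?lnXn ?ltr0n ?mulr_natl // -natrX.
  by rewrite ler_ln ?posrE // ler_nat.
have h4 : ln T <= logb T by rewrite /logb ler_ln ?posrE ?lt_max ?ltr0n // le_max lexx orbT.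
have := logb_ge T.
have : 3 * logb T <= v%:R * ln 2.
  by move: Hv; rewrite mulrA ler_pdivrMr.
lra.
Qed.

(** With X = 2^v, [prime_between] gives X^(2d + 3) < p <= 16 X^(4d + 6). The lower bound exceeds K^d
    (d K + 2) for K <= X, and the upper bound gives ln p <= (4d + 10) v. *)
Lemma exists_good_prime (v : nat) : exists p, [/\ prime p,
  forall K, (K <= 2 ^ v)%N -> (K <= p)%N && (K ^ d * (d * K + 2) <= p)%N &
  (0 < v)%N -> log_bound p <= (8 * d + 23)%:R * v%:R :> R].
Proof.
have [->|v0] := posnP v.
  have [p pp /andP[np _]] := @prime_between (d + 2) ltac:(lia).
  exists p; split=> // -[|[|//]] _; rewrite ?exp1n; try lia.
  by rewrite exp0n //; lia.
set X := (2 ^ v)%N; have X2 : (2 <= X)%N by rewrite -{1}(expn1 2) leq_exp2l.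
have [p pp /andP[np pn]] := @prime_between (X ^ (2 * d + 3)) ltac:(rewrite expn_gt0; lia).
have XX : (X <= X ^ (2 * d + 3))%N by rewrite -{1}(expn1 X) leq_exp2l; lia.
exists p; split=> [//|K KX|_].
  apply/andP; split; first by lia.
  apply: (@leq_trans (X ^ (2 * d + 3))); last exact: ltnW.
  apply: (@leq_trans (X ^ d * (d * X + 2))).
    by rewrite leq_mul ?leq_exp2r // leq_add2r leq_mul2l KX orbT.
  rewrite (_ : 2 * d + 3 = d + (d + 3))%N; last lia.
  rewrite expnD leq_mul2l; apply/orP; right.
  have dX : (d <= X ^ d)%N by apply: ltnW; apply: ltn_expl; lia.
  have XX1 : (X ^ (d + 3) = X ^ d * X * (X * X))%N by rewrite expnD !expnS expn0; lia.
  rewrite XX1; have : (1 <= X ^ d)%N by rewrite expn_gt0; lia.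
  set Y := (X ^ d)%N in dX * => Y1.
  have h1 : (Y * X * 4 <= Y * X * (X * X))%N by rewrite leq_mul // (leq_mul X2 X2).
  have h2 : (d * X <= Y * X)%N by rewrite leq_mul.
  have h3 : (1 * 2 <= Y * X)%N by rewrite leq_mul.
  by lia.
have lp : ln p%:R <= (4 * d + 10)%:R * v%:R :> R.
  apply: (@le_trans _ _ (ln (2 ^+ (v * (4 * d + 10))))).
    rewrite ler_ln ?posrE ?ltr0n ?prime_gt0 ?exprn_gt0 // -natrX ler_nat.
    apply: leq_trans pn _; rewrite expnM -/X.
    rewrite (_ : 4 * d + 10 = 4 + (2 * d + 3) * 2)%N; last lia.
    rewrite (expnD X 4) (expnM X _ 2) leq_mul2r; apply/orP; right.
    by rewrite -[16%N]/(2 ^ 4)%N leq_exp2r.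
  rewrite lnXn ?ltr0n // -[leLHS]mulr_natl natrM [v%:R * _]mulrC.
  by rewrite ler_piMr ?ln2_le1 // mulr_ge0.
have v1 : 1 <= v%:R :> R by rewrite ler1n.
move: lp; rewrite /log_bound (natrD _ (4 * d)) (natrM _ 4) (natrD _ (8 * d)) (natrM _ 8).
have dv : 0 <= d%:R * v%:R :> R by rewrite mulr_ge0.
lra.
Qed.

Lemma discrepancy_almost_all (eps : R) : 0 < eps ->
  lebesgue_almost_all (fun L : 'M[R]_(m, d) => exists2 C : R, 0 < C &
    forall (T : R) (K : nat) sigma alpha beta, 1 <= T -> K%:R <= 3 * T ->
      (forall i, 0 <= alpha i) -> (forall i, alpha i <= beta i) ->
      (forall i, beta i <= 1) ->
      `|(box_count L K sigma alpha beta)%:R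
         - K%:R ^+ d * \prod_(i < m) (beta i - alpha i)|
      <= C * logb T `^ ((d + m)%:R + eps)).
Proof.
move=> e0; set D := (m * d)%N.
(* This b lets V_j^eps = 2^(b j eps) absorb the factor 2^(j (D + 1)) in [lam]. *)
have [b b0 be] : exists2 b : nat, (0 < b)%N & D.+1%:R <= b%:R * eps.
  have De : 0 <= D.+1%:R / eps by rewrite divr_ge0 // ltW.
  exists (Num.truncn (D.+1%:R / eps)).+1 => //.
  by have /andP[_ /ltW] := truncn_itv De; rewrite ler_pdivrMr.
pose V j := (2 ^ (b * j))%N.
have V0 j : (0 < V j)%N by rewrite expn_gt0.
have [p Hp] := choice (fun j => exists_good_prime (V j)).
(* The power of V_j matches the mean of [fourier_bound], of order (log p)^(d + m). In the second
   factor, 2^(j D) pays for the number of integer parts and the remaining 2^j makes the measures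
   summable. *)
pose lam j : R := (V j)%:R ^+ (d + m) * 2 ^+ (j * D.+1).
have lam1 j : 1 <= lam j.
  by rewrite mulr_ege1 // exprn_ege1 // ?ler1n.
have lam0 j : 0 < lam j by apply: lt_le_trans (lam1 j).
pose c : R := (8 * d + 23)%:R.
have vol j : (2 * j + 1)%:R ^+ D * (log_bound (p j) ^+ (d + m) / lam j)
    <= 3 ^+ D * c ^+ (d + m) / 2 ^+ j.
  have [pp _ /(_ (V0 j)) lb] := Hp j.
  have V0R : 0 < (V j)%:R :> R by rewrite ltr0n.
  have lb1 := log_bound_ge1 (R := R) pp.
  have H1 : (2 * j + 1)%:R ^+ D <= 3 ^+ D * 2 ^+ (j * D) :> R.
    rewrite exprM -exprMn lerXn2r ?nnegrE ?mulr_ge0 ?exprn_ge0 //.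
    by rewrite -natrX -natrM ler_nat; have := ltn_expl j (isT : 1 < 2)%N; lia.
  have H2 : log_bound (p j) ^+ (d + m) / lam j <= c ^+ (d + m) / 2 ^+ (j * D.+1) :> R.
    rewrite /lam invfM mulrA ler_pM2r ?invr_gt0 ?exprn_gt0 //.
    rewrite ler_pdivrMr ?exprn_gt0 // -exprMn lerXn2r ?nnegrE ?mulr_ge0 //.
    by apply: le_trans lb1.
  apply: (@le_trans _ _ ((3 ^+ D * 2 ^+ (j * D)) * (c ^+ (d + m) / 2 ^+ (j * D.+1)))).
    apply: ler_pM; rewrite ?exprn_ge0 //.
    by rewrite divr_ge0 ?(ltW (lam0 j)) // exprn_ge0 //; apply: le_trans lb1.
  have Y0 : 2 ^+ (j * D) != 0 :> R by rewrite expf_neq0.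
  rewrite mulnS (exprD 2 j) invfM -!mulrA ler_wpM2l ?exprn_ge0 //.
  by rewrite mulrC -!mulrA mulVf ?mulr1.
have Kp j : (2 ^ V j <= p j)%N by have [_ /(_ _ (leqnn _))/andP[]] := Hp j.
have pp j : prime (p j) by have [] := Hp j.
have := eventually_fourier_bound_le m_gt0 d_gt0 pp Kp lam0 vol.
apply: lebesgue_almost_all_imply => L [J HJ].
(* The first term is the trivial bound for scales below J; m + 1 covers the rounding error and
   [fourier_bound] from J on. *)
pose C0 : R := (2 ^ V J)%:R ^+ d + m%:R + 1.
have C00 : 0 < C0 by rewrite ltr_wpDl // addr_ge0 // exprn_ge0.
have l2 := @ln2_gt0.
pose B : R := (2 ^ b)%:R * (3 / ln 2).
have B0 : 0 < B by rewrite mulr_gt0 ?divr_gt0 // ltr0n expn_gt0.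
exists (C0 * B `^ ((d + m)%:R + eps)); first by rewrite mulr_gt0 // powR_gt0.
move=> T K sigma alpha beta T1 KT a0 ab b1.
have u1 : 1 <= logb T / ln 2 by rewrite ler_pdivlMr // mul1r logb_ge.
have exj : exists j, 3 * (logb T / ln 2) <= (V j)%:R.
  have u0 : 0 <= 3 * (logb T / ln 2) by lra.
  exists (Num.truncn (3 * (logb T / ln 2))).+1.
  have /andP[_ /ltW H] := truncn_itv u0; apply: le_trans H _.
  rewrite ler_nat ltnW //; apply: leq_trans (ltn_expl _ (isT : 1 < 2)%N) _.
  by rewrite leq_exp2l // leq_pmull.
(* The least admissible index is positive, because V_0 = 1 is below 3 [logb T] / ln 2. Minimality
   bounds V_j above, and V_(j+1) = 2^b V_j gives the constant [B]. *)
case: (ex_minnP exj) => -[|j] Hj jmin.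
  by move: Hj; rewrite /V muln0 expn0; lra.
have KV : (K <= 2 ^ V j.+1)%N by exact: le_nat_of_logb Hj.
have Vj : (V j.+1)%:R <= B * logb T.
  have : ~~ (3 * (logb T / ln 2) <= (V j)%:R).
    by apply/negP => /jmin; rewrite ltnn.
  rewrite -ltNge => /ltW H.
  rewrite /V mulnS expnD natrM /B -mulrA ler_pM2l ?ltr0n ?expn_gt0 //.
  by rewrite mulrAC -mulrA.
have main : `|(box_count L K sigma alpha beta)%:R
    - K%:R ^+ d * \prod_(i < m) (beta i - alpha i)| <= C0 * lam j.+1.
  have [Jj|jJ] := leqP J j.+1.
    have [_ /(_ K KV)/andP[_ Kd] _] := Hp j.+1.
    apply: le_trans (box_discrepancy (pp j.+1) L sigma a0 ab b1 Kd) _.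
    apply: (@le_trans _ _ (lam j.+1 + m%:R * lam j.+1)).
      apply: lerD; last by rewrite ler_peMr.
      apply: le_trans (HJ _ Jj); exact: le_fourier_bound.
    rewrite -[X in X + _]mul1r -mulrDl ler_pM2r // /C0 addrC lerD2r lerDr.
    exact: exprn_ge0.
  apply: le_trans (box_count_trivial L K sigma a0 ab b1) _.
  apply: (@le_trans _ _ C0); last by rewrite ler_peMr // ltW.
  apply: (@le_trans _ _ ((2 ^ V J)%:R ^+ d)); last by rewrite /C0 -addrA lerDl.
  rewrite lerXn2r ?nnegrE // ler_nat; apply: leq_trans KV _.
  by rewrite !leq_exp2l // leq_mul2l ltnW ?orbT.
apply: le_trans main _; rewrite -mulrA ler_pM2l //.
have lT : 0 < logb T by apply: lt_le_trans l2 (logb_ge T).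
have e1 : 0 <= (d + m)%:R + eps by rewrite addr_ge0 // ltW.
rewrite -powRM ?(ltW B0) ?(ltW lT) //.
(* By the choice of b, 2^((j+1)(D+1)) <= V_(j+1)^eps, so [lam j.+1] is at most V_(j+1)^(d + m +
   eps). *)
apply: (@le_trans _ _ ((V j.+1)%:R `^ ((d + m)%:R + eps))); last first.
  apply: ge0_ler_powR => //; rewrite nnegrE //.
  by apply: mulr_ge0; exact: ltW.
rewrite powRD; last by rewrite pnatr_eq0 -lt0n V0 implybT.
rewrite powR_mulrn // ler_wpM2l ?exprn_ge0 //.
have -> : (V j.+1)%:R = 2 `^ (b * j.+1)%:R :> R by rewrite powR_mulrn // natrX.
rewrite -powRrM -powR_mulrn //.
apply: ler_powR; first by rewrite ler1n.
rewrite !natrM mulrAC [leRHS]mulrC mulrC.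
rewrite [_ * j.+1%:R]mulrC ler_wpM2l //.
Qed.

End MetricDiscrepancy.

(** * Acceptance domains of patches *)

(** Each condition places t in a half-open unit interval, and a finite intersection of such
    intervals with [0, 1) is again half-open. *)
Lemma interval_floor_conditions (R : realType) (I : finType) (c : I -> R)
    (e : I -> int) : exists a b : R, [/\ 0 <= a, a <= b, b <= 1 &
  forall t, (a <= t < b) = (0 <= t < 1) && [forall i, Num.floor (t - c i) == e i]].
Proof.
suff [a [b [a0 ab b1 H]]] : exists a b : R, [/\ 0 <= a, a <= b, b <= 1 &
    forall t, (a <= t < b) = (0 <= t < 1) &&
      all (fun i => Num.floor (t - c i) == e i) (enum I)].
  exists a, b; split=> // t; rewrite H; congr (_ && _).
  apply/allP/forallP => [h i|h i _]; last exact: h.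
  by apply: h; rewrite mem_enum.
elim: (enum I) => [|i s [a [b [a0 ab b1 H]]]].
  by exists 0, 1; split=> // t; rewrite andbT.
have fE t : (Num.floor (t - c i) == e i) = (c i + (e i)%:~R <= t < c i + (e i)%:~R + 1).
  apply/eqP/idP => [<-|h].
    by have := floor_itv (t - c i); rewrite intrD => /andP[? ?]; apply/andP; split; lra.
  by apply: floor_def; rewrite intrD; case/andP: h => ? ?; apply/andP; split; lra.
pose a' := Num.max a (c i + (e i)%:~R).
pose b' := Num.min b (c i + (e i)%:~R + 1).
have tE t : (a' <= t < b') = (a <= t < b) && (Num.floor (t - c i) == e i).
  by rewrite fE /a' /b' ge_max lt_min; case: (a <= t); case: (t < b); rewrite /= ?andbF ?andbT.
have [ab'|ba'] := leP a' b'.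
  exists a', b'; split=> //.
  - by rewrite le_max a0.
  - by rewrite ge_min b1.
  - by move=> t; rewrite tE H /= -andbA; congr (_ && _); rewrite andbC.
(* An empty intersection is represented by [0, 0), which keeps a <= b. *)
exists 0, 0; split=> // t; rewrite [LHS](_ : _ = false); last by apply/negP => /andP[? ?]; lra.
symmetry; rewrite /= andbCA -H andbC -tE; apply/negP => /andP[? ?]; lra.
Qed.

Section CutAndProject.
Context {R : realType} {d m : nat}.
Local Notation Rk := 'rV[R]_(d + m).
Variable L : 'M[R]_(m, d).

(* The coordinates of the projection along the physical space E onto
   {0} x R^m; it identifies the internal space with R^m and the window with
   the unit cube. *)
Definition height (v : Rk) : 'rV[R]_m := rsubmx v - lsubmx v *m L^T.

Lemma heightD v w : height (v + w) = height v + height w.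
Proof. by rewrite /height !raddfD /= mulmxDl opprD addrACA. Qed.

Lemma heightB v w : height (v - w) = height v - height w.
Proof. by have := heightD (v - w) w; rewrite subrK => ->; rewrite addrK. Qed.

Lemma heightDE v w j : height (v + w) 0 j = height v 0 j + height w 0 j.
Proof. by rewrite heightD [LHS]mxE. Qed.

Lemma heightE v j : height v 0 j = rsubmx v 0 j - (lsubmx v *m L^T) 0 j.
Proof. by rewrite /height mxE [X in _ + X]mxE. Qed.

Lemma height_row_mx a b : height (row_mx a b) = b - a *m L^T.
Proof. by rewrite /height row_mxKl row_mxKr. Qed.

Lemma physical_heightP v : reflect (height v = 0) (v \in physical L).
Proof.
apply: (iffP (physicalP L v)) => [[x ->]|/eqP].
  by rewrite height_row_mx /linmap_of subrr.
rewrite subr_eq0 => /eqP H; exists (lsubmx v).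
by rewrite /linmap_of -H hsubmxK.
Qed.

Variable F : {vspace Rk}.
Hypothesis adm : admissible L F.

Lemma cprojB v w : cproj L F (v - w) = cproj L F v - cproj L F w.
Proof. exact: linearB. Qed.

Lemma cprojD v w : cproj L F (v + w) = cproj L F v + cproj L F w.
Proof. exact: linearD. Qed.

(** A vector and its internal projection differ by an element of the physical space, where [height]
    vanishes. Thus heights alone describe the slice. *)
Lemma cproj_star_height v : height (cproj_star L F v) = height v.
Proof.
have [full cap _] := adm.
have E : cproj L F v + cproj_star L F v = v.
  by apply: daddv_pi_add => //; rewrite full memvf.
rewrite -[in RHS]E heightD.
by have /physical_heightP -> := memv_pi (physical L) F v; rewrite add0r.
Qed.

Lemma sliceE v : slice L F v <-> forall j, 0 <= height v 0 j <= 1.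
Proof.
split=> [[w [x [x0 x1] <-]] [e eE <-] j|H].
  rewrite heightD cproj_star_height (physical_heightP _ eE) addr0.
  by rewrite /height x0 mul0mx subr0.
have hE : height (row_mx 0 (height v)) = height v.
  by rewrite height_row_mx mul0mx subr0.
exists (cproj_star L F (row_mx 0 (height v))).
  by exists (row_mx 0 (height v)) => //=; rewrite row_mxKl row_mxKr.
exists (v - cproj_star L F (row_mx 0 (height v))); last by rewrite addrC subrK.
by apply/physical_heightP; rewrite heightB cproj_star_height hE subrr.
Qed.

Lemma ZkD (x y : Rk) : Zk x -> Zk y -> Zk (x + y).
Proof. by move=> hx hy j; rewrite mxE rpredD. Qed.

Lemma ZkB (x y : Rk) : Zk x -> Zk y -> Zk (x - y).
Proof. by move=> hx hy j; rewrite mxE [(- y) 0 j]mxE rpredB. Qed.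

Lemma Zk_row_mx (a : 'rV[R]_d) (b : 'rV[R]_m) :
  (forall j, a 0 j \is a Num.int) -> (forall j, b 0 j \is a Num.int) ->
  Zk (row_mx a b).
Proof.
by move=> ha hb j; rewrite mxE; case: (fintype.splitP j) => k _; rewrite ?ha ?hb.
Qed.

Lemma Zk_lsubmx (x : Rk) j : Zk x -> lsubmx x 0 j \is a Num.int.
Proof. by move=> hx; rewrite mxE. Qed.

Lemma Zk_rsubmx (x : Rk) j : Zk x -> rsubmx x 0 j \is a Num.int.
Proof. by move=> hx; rewrite mxE. Qed.

Lemma Zk_shiftD (s z x : Rk) : Zk_shift s z -> Zk x -> Zk_shift s (z + x).
Proof. by case=> n hn <- hx; exists (n + x); [exact: ZkD|rewrite addrAC]. Qed.

Lemma Zk_shiftB (s z z' : Rk) : Zk_shift s z -> Zk_shift s z' -> Zk (z - z').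
Proof. by case=> n hn <- [n' hn' <-]; rewrite opprD addrACA subrr addr0; exact: ZkB. Qed.

Lemma cproj_inj (x y : Rk) : Zk (x - y) -> cproj L F x = cproj L F y -> x = y.
Proof.
have [_ _ inj] := adm => hxy E; apply/eqP; rewrite -subr_eq0; apply/eqP.
apply: inj; rewrite ?inE //; last by rewrite cprojB E subrr /cproj linear0.
by move=> j; rewrite mxE.
Qed.

Lemma lift_ptE (s z : Rk) : Zk_shift s z -> lift_pt L F s (cproj L F z) = z.
Proof.
move=> hz; apply: get_subset1 => // x y [hx ex] [hy ey].
by apply: cproj_inj; [exact: Zk_shiftB hx hy | rewrite ex ey].
Qed.

(** If height j were an integer, a lattice translate would have all heights in [0, 1) and height j
    equal to 0. It would lie in the slice, but slightly lowering height j would leave it, so it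
    would be a boundary point. *)
Lemma regular_height (s z : Rk) : regular L F s -> Zk_shift s z ->
  forall j, height z 0 j \isn't a Num.int.
Proof.
move=> reg hz j; apply/negP => hj.
pose b : 'rV[R]_m := \row_i - (Num.floor (height z 0 i))%:~R.
have bZ : Zk (row_mx 0 b : Rk).
  by apply: Zk_row_mx => i; rewrite mxE ?rpredN ?rpred0 // intr_int.
pose z' := z + row_mx 0 b.
have hE i : height z' 0 i = frac (height z 0 i).
  by rewrite heightDE height_row_mx mul0mx subr0 [X in _ + X]mxE.
have : (boundary (slice L F) `&` Zk_shift s) z'; last by rewrite reg.
split; last exact: Zk_shiftD.
split.
  apply: subset_closure; apply/sliceE => i; rewrite hE /frac.
  have := floor_itv (height z 0 i); rewrite intrD => /andP[? ?].
  by apply/andP; split; lra.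
rewrite /interior => /nbhs_ballP[e /= e0 He].
pose u : Rk := row_mx 0 (\row_i (- (e / 2) *+ (i == j))).
have : ball z' e (z' + u).
  split=> // i l; rewrite /ball /= [(z' + u) i l]mxE opprD addrA subrr add0r normrN [u i l]mxE.
  case: (fintype.splitP l) => k _; rewrite mxE ?normr0 //.
  by case: (k == j); rewrite ?mulr0n ?normr0 // mulr1n normrN gtr0_norm; lra.
move/He/sliceE => /(_ j); rewrite heightDE height_row_mx mul0mx subr0 hE.
rewrite [X in _ + X]mxE eqxx mulr1n /frac; case/intrP: hj => n ->; rewrite intrKfloor subrr.
by case/andP; lra.
Qed.

Lemma height_nonint (s z x : Rk) j : regular L F s -> Zk_shift s z -> Zk x ->
  height z 0 j + height x 0 j \isn't a Num.int.
Proof.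
move=> reg hz hx; have -> : height z 0 j + height x 0 j = height (z + x) 0 j.
  by rewrite heightDE.
exact: regular_height reg (Zk_shiftD hz hx) j.
Qed.

(** Written with displacements x = z' - z, the class depends on z only through its height. *)
Lemma patch_classE (s z : Rk) (r : R) : Zk_shift s z ->
  patch_class L F s r (cproj L F z) =
  cproj L F @` [set x | Cbox r x /\ forall j, 0 <= height z 0 j + height x 0 j <= 1].
Proof.
move=> hz; rewrite /patch_class /Defs.patch lift_ptE //; apply/seteqP; split.
  move=> _ [y [[z' [sz' hz'] <-] C] <-]; rewrite lift_ptE // in C.
  exists (z' - z); last by rewrite cprojB.
  split=> // j; move/sliceE: sz' => /(_ j).
  have -> : height z' 0 j = height z 0 j + height (z' - z) 0 j.
    by rewrite -heightDE addrC subrK.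
  by [].
move=> _ [x [C H] <-]; have hzx := Zk_shiftD hz C.1.
exists (cproj L F (z + x)); last by rewrite cprojD addrC addKr.
split; last by rewrite lift_ptE // addrC addKr.
by exists (z + x) => //; split=> //; apply/sliceE => j; rewrite heightDE; exact: H.
Qed.

Lemma eq_image_cproj (A B : set Rk) : A `<=` Zk -> B `<=` Zk ->
  cproj L F @` A = cproj L F @` B -> A = B.
Proof.
move=> AZ BZ E; apply/seteqP; split=> x hx.
  have : (cproj L F @` B) (cproj L F x) by rewrite -E; exists x.
  case=> y hy /cproj_inj <- //; apply: ZkB; [exact: BZ|exact: AZ].
have : (cproj L F @` A) (cproj L F x) by rewrite E; exists x.
case=> y hy /cproj_inj <- //; apply: ZkB; [exact: AZ|exact: BZ].
Qed.

(** Subtracting M centres the index cube, giving the integer points of [-M, M]^d. *)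
Definition box_vec (M : nat) (n : {ffun 'I_d -> 'I_(2 * M + 1)}) : 'rV[R]_d :=
  \row_j ((n j)%:R - M%:R).

Lemma box_vec_int M n j : @box_vec M n 0 j \is a Num.int.
Proof. by rewrite mxE rpredB ?natr_int. Qed.

Lemma box_vec_le (T : R) n j : 0 <= T -> `|@box_vec (Num.truncn T) n 0 j| <= T.
Proof.
move=> T0; have /andP[tT _] := truncn_itv T0; apply: le_trans tT.
rewrite mxE ler_norml; set M := Num.truncn T in n *.
have nM : (n j)%:R <= 2 * M%:R :> R.
  by rewrite -natrM ler_nat; have := ltn_ord (n j); lia.
have n0 : 0 <= (n j)%:R :> R by [].
by apply/andP; split; lra.
Qed.

Lemma exists_box_vec (T : R) (a : 'rV[R]_d) : 0 <= T ->
  (forall j, a 0 j \is a Num.int) -> (forall j, `|a 0 j| <= T) ->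
  exists n, a = @box_vec (Num.truncn T) n.
Proof.
move=> T0 aZ aT; set M := Num.truncn T.
have H j : exists n : 'I_(2 * M + 1), a 0 j = n%:R - M%:R.
  have /intrP[k ak] := aZ j.
  have kM : (absz k <= M)%N.
    rewrite /M truncn_ge_nat //; apply: le_trans (aT j).
    by rewrite ak natr_absz intr_norm.
  have lt : (absz (k + M%:Z)%R < 2 * M + 1)%N by lia.
  exists (Ordinal lt); rewrite /= ak.
  have -> : (absz (k + M%:Z)%R)%:R = (k + M%:Z)%:~R :> R.
    by rewrite pmulrn gez0_abs //; lia.
  by rewrite intrD -pmulrn addrK.
have [f fE] := choice H; exists [ffun j => f j]; apply/rowP => j.
by rewrite [RHS]mxE ffunE fE.
Qed.

Lemma box_vec_inj M : injective (@box_vec M).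
Proof.
move=> n n' /rowP E; apply/ffunP => j; apply/val_inj/eqP.
by have := E j; rewrite !mxE => /addIr/eqP; rewrite eqr_nat.
Qed.

(** The closed unit interval may be replaced by [0, 1), since its endpoints are integers; then b +
    (w - c) in [0, 1) fixes the floor of w - c. *)
Lemma nonint_itvP (w h : R) : w + h \isn't a Num.int -> forall b, b \is a Num.int ->
  forall c, h = b - c ->
  (0 <= w + h <= 1) = (Num.floor (w - c) == - Num.floor b).
Proof.
move=> ni b /intrP[k bE] c hE; rewrite bE intrKfloor.
apply/idP/eqP => [/andP[h0 h1]|fE].
  have h1' : w + h < 1.
    rewrite lt_neqAle h1 andbT; apply: contra ni => /eqP ->; exact: int_num1.
  apply: floor_def; rewrite intrD mulrNz.
  by apply/andP; split; move: h0 h1'; rewrite hE bE; lra.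
have := floor_itv (w - c); rewrite fE intrD mulrNz => /andP[? ?].
by rewrite hE bE; apply/andP; split; lra.
Qed.

(* On regular points the acceptance domain of a patch class is a product of
   intervals: coordinate j of the height only enters through the integers
   floor (w_j - (a L^T)_j) with a in Z^d and |a| <= r. *)
Lemma acceptance_floor (s1 z1 s2 z2 : Rk) (r : R) : 0 <= r ->
  regular L F s1 -> Zk_shift s1 z1 -> regular L F s2 -> Zk_shift s2 z2 ->
  patch_class L F s1 r (cproj L F z1) = patch_class L F s2 r (cproj L F z2) <->
  forall (n : {ffun 'I_d -> 'I_(2 * Num.truncn r + 1)}) j,
    Num.floor (height z1 0 j - (box_vec n *m L^T) 0 j) =
    Num.floor (height z2 0 j - (box_vec n *m L^T) 0 j).
Proof.
move=> r0 reg1 h1 reg2 h2; rewrite !patch_classE //.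
have itv s z x j : regular L F s -> Zk_shift s z -> Zk x ->
    (0 <= height z 0 j + height x 0 j <= 1) =
    (Num.floor (height z 0 j - (lsubmx x *m L^T) 0 j) == - Num.floor (rsubmx x 0 j)).
  move=> reg hz hx; apply: nonint_itvP; first exact: height_nonint reg hz hx.
    exact: Zk_rsubmx.
  exact: heightE.
split=> [/eq_image_cproj E n j|E].
  have {}E := E (fun x h => h.1.1) (fun x h => h.1.1).
  (* The lattice displacement over [box_vec n] that keeps [z1] in the slice. As it must also keep
     [z2] there, it determines the floors for [z2]. *)
  pose x : Rk := row_mx (box_vec n)
    (\row_i - (Num.floor (height z1 0 i - (box_vec n *m L^T) 0 i))%:~R).
  have xZ : Zk x.
    apply: Zk_row_mx => i; first exact: box_vec_int.
    by rewrite mxE rpredN intr_int.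
  have rE i : rsubmx x 0 i =
      (- Num.floor (height z1 0 i - (box_vec n *m L^T) 0 i))%:~R.
    by rewrite row_mxKr mxE mulrNz.
  have xC : Cbox r x by split=> // i; rewrite row_mxKl box_vec_le.
  have : [set x | Cbox r x /\ forall j, 0 <= height z1 0 j + height x 0 j <= 1] x.
    by split=> // i; rewrite (itv s1) // rE row_mxKl intrKfloor opprK.
  rewrite E => -[_ /(_ j)]; rewrite (itv s2) // rE row_mxKl.
  by rewrite intrKfloor opprK => /eqP.
congr (_ @` _); apply/seteqP; split=> x [xC H]; split=> // j; move: (H j);
  have [n an] := exists_box_vec r0 (fun j => Zk_lsubmx j xC.1) xC.2;
  by rewrite (itv s1 z1 x j reg1 h1 xC.1) (itv s2 z2 x j reg2 h2 xC.1) an E.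
Qed.

Lemma ncard_image (I : finType) (f : I -> Rk) (B : pred I) (A : set Rk) :
  injective f -> (forall y, A y <-> exists2 n, B n & f n = y) ->
  ncard A = #|B|.
Proof.
move=> finj AE; pose X := seq_fset tt [seq f n | n in B].
have -> : A = [set` X].
  apply/seteqP; split=> y.
    case/AE => n Bn <-; rewrite /= seq_fsetE; apply/fintype.imageP; by exists n.
  by rewrite /= seq_fsetE => /fintype.imageP[n Bn ->]; apply/AE; exists n.
rewrite /ncard set_fsetK size_seq_fset undup_id ?size_image //.
by rewrite map_inj_uniq ?enum_uniq.
Qed.

(** * Points of the cut and project set over an integer cube *)

Section Counting.
Variables (s z : Rk) (T : R).
Hypotheses (reg : regular L F s) (hz : Zk_shift s z) (T0 : 0 <= T).
Local Notation M := (Num.truncn T).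

(** The second term compensates for the centring in [box_vec], so that [rot_point] can use indices
    from 0. *)
Definition box_shift (j : 'I_m) : R := height z 0 j + M%:R * \sum_(i < d) L j i.

(** Subtracting the floors brings every height into [0, 1), so this is the point of the slice over
    the displacement [box_vec n]. *)
Definition slice_point (n : {ffun 'I_d -> 'I_(2 * M + 1)}) : Rk :=
  z + row_mx (box_vec n)
    (\row_j - (Num.floor (height z 0 j - (box_vec n *m L^T) 0 j))%:~R).

Lemma slice_pointZ n : Zk (slice_point n - z).
Proof.
rewrite addrC addKr; apply: Zk_row_mx => j; first exact: box_vec_int.
by rewrite mxE rpredN intr_int.
Qed.

Lemma slice_point_shift n : Zk_shift s (slice_point n).
Proof. by have := Zk_shiftD hz (slice_pointZ n); rewrite addrC subrK. Qed.

Lemma slice_point_height n j :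
  height (slice_point n) 0 j = frac (rot_point L box_shift (fun i => n i) j).
Proof.
have -> : rot_point L box_shift (fun i => n i) j =
    height z 0 j - (box_vec n *m L^T) 0 j.
  rewrite /rot_point /box_shift -addrA; congr (_ + _).
  rewrite [X in _ = - X]mxE mulr_sumr -sumrB -sumrN; apply: eq_bigr => i _.
  by rewrite !mxE; ring.
rewrite heightDE [X in _ + X]heightE row_mxKl row_mxKr.
by rewrite [(\row__ _) 0 j]mxE /frac; ring.
Qed.

Lemma frac01 (x : R) : 0 <= frac x < 1.
Proof.
have := floor_itv x; rewrite /frac intrD => /andP[? ?].
by apply/andP; split; lra.
Qed.

Lemma slice_point_slice n : slice L F (slice_point n).
Proof.
apply/sliceE => j; rewrite slice_point_height.
by have /andP[-> /ltW ->] := frac01 (rot_point L box_shift (fun i => n i) j).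
Qed.

(** By regularity no height is an integer, so the first d coordinates force the remaining ones. *)
Lemma slice_point_exists z' : slice L F z' -> Zk_shift s z' -> Cbox T (z' - z) ->
  exists n, z' = slice_point n.
Proof.
move=> /sliceE sz' hz' C.
have [n an] := exists_box_vec T0 (fun j => Zk_lsubmx j C.1) C.2.
exists n; rewrite /slice_point -an.
suff -> : \row_j - (Num.floor (height z 0 j - (lsubmx (z' - z) *m L^T) 0 j))%:~R =
    rsubmx (z' - z) by rewrite hsubmxK addrC subrK.
apply/rowP => j; rewrite mxE.
have := sz' j; have -> : height z' 0 j = height z 0 j + height (z' - z) 0 j.
  by rewrite -heightDE addrC subrK.
rewrite (@nonint_itvP _ _ (height_nonint j reg hz C.1) _ (Zk_rsubmx j C.1)
  ((lsubmx (z' - z) *m L^T) 0 j)); last exact: heightE.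
move=> /eqP ->; have /intrP[k ->] := Zk_rsubmx j C.1.
by rewrite intrKfloor mulrNz opprK.
Qed.

Lemma slice_point_inj : injective slice_point.
Proof.
by move=> n n' /addrI E; apply: box_vec_inj; rewrite -(row_mxKl (box_vec n) 
  (\row_j - (Num.floor (height z 0 j - (box_vec n *m L^T) 0 j))%:~R)) E row_mxKl.
Qed.

Lemma ncard_cps (Q : Rk -> Prop) (B : pred {ffun 'I_d -> 'I_(2 * M + 1)}) :
  (forall n, Q (cproj L F (slice_point n)) <-> B n) ->
  ncard [set y' | [/\ cps L F s y', Q y' &
    Cbox T (lift_pt L F s y' - lift_pt L F s (cproj L F z))]] = #|B|.
Proof.
move=> QB; apply: (@ncard_image _ (fun n => cproj L F (slice_point n))).
  move=> n n' /cproj_inj E; apply: slice_point_inj; apply: E.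
  exact: Zk_shiftB (slice_point_shift n) (slice_point_shift n').
move=> y; split=> [[[z' [sz' hz'] <-]]|[n Bn <-]].
  rewrite !lift_ptE // => Qz' C.
  by have [n zE] := slice_point_exists sz' hz' C; exists n; [apply/QB|]; rewrite -?zE.
split; last 2 first.
- exact/QB.
- rewrite !lift_ptE //; last exact: slice_point_shift.
  split; first exact: slice_pointZ.
  by move=> j; rewrite addrC addKr row_mxKl box_vec_le.
exists (slice_point n) => //; split; first exact: slice_point_slice.
exact: slice_point_shift.
Qed.

End Counting.

(** The class fixes finitely many floors in each coordinate by [acceptance_floor], hence an interval
    for each height. The same box serves every s, z and T, and the denominator is exactly the number
    of points of the integer cube. *)
Lemma xi_box_count (s1 z1 : Rk) (r : R) : 0 <= r ->
  regular L F s1 -> Zk_shift s1 z1 ->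
  exists alpha beta : 'I_m -> R, [/\ forall j, 0 <= alpha j,
    forall j, alpha j <= beta j, forall j, beta j <= 1 &
    forall s z T, regular L F s -> Zk_shift s z -> 0 <= T ->
      xi L F s r (patch_class L F s1 r (cproj L F z1)) (cproj L F z) T =
      (box_count L (2 * Num.truncn T + 1) (box_shift z T) alpha beta)%:R /
      (2 * Num.truncn T + 1)%:R ^+ d].
Proof.
move=> r0 reg1 hz1.
have H j := interval_floor_conditions
  (fun n : {ffun 'I_d -> 'I_(2 * Num.truncn r + 1)} => (box_vec n *m L^T) 0 j)
  (fun n => Num.floor (height z1 0 j - (box_vec n *m L^T) 0 j)).
have [alpha {}H] := choice H; have [beta {}H] := choice H.
exists alpha, beta; split=> [j|j|j|s z T reg hz T0]; try by have [] := H j.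
rewrite /xi; congr (_%:R / _).
  apply: ncard_cps => // n; rewrite /= acceptance_floor //; last exact: slice_point_shift.
  split=> [E|/forallP E n' j].
    apply/forallP => j; have [_ _ _ ->] := H j; rewrite frac01 /=.
    by apply/forallP => n'; rewrite -E slice_point_height.
  have [_ _ _ HE] := H j; move: (E j); rewrite HE => /andP[_ /forallP/(_ n')/eqP <-].
  by rewrite slice_point_height.
rewrite -natrX; congr (_%:R).
transitivity (ncard [set y' | [/\ cps L F s y', True &
    Cbox T (lift_pt L F s y' - lift_pt L F s (cproj L F z))]]).
  congr ncard; apply/seteqP; split=> y; first by case.
  by case.
rewrite (@ncard_cps s z T reg hz T0 (fun=> True) predT) //.
by rewrite card_ffun !card_ord.
Qed.

End CutAndProject.

(** * Convergence to the frequency *)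

(** From ln x <= x - 1 at x = T^(1/(2a)) one gets (ln T)^a <= (2a)^a T^(1/2), so the quotient is at
    most a constant times T^(-1/2). The summand 2 in the threshold ensures [logb T] = ln T. *)
Lemma logb_powR_div_small (R : realType) (d : nat) (a C e : R) : (0 < d)%N ->
  0 < a -> 0 < C -> 0 < e ->
  exists2 M : R, 1 <= M & forall T, M <= T -> C * (logb T `^ a / T ^+ d) <= e.
Proof.
move=> d0 a0 C0 e0; pose c := (2 * a) `^ a.
have c0 : 0 < c by rewrite powR_gt0 // mulr_gt0.
exists (2 + (C * c / e) ^+ 2) => [|T MT]; first by have := sqr_ge0 (C * c / e); lra.
have T2 : 2 <= T by have := sqr_ge0 (C * c / e); lra.
have T0 : 0 < T by lra.
have lT : logb T = ln T by rewrite /logb; congr ln; apply/max_idPr.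
have a2 : 0 < 2 * a by rewrite mulr_gt0.
have ln_le : ln T <= 2 * a * T `^ (2 * a)^-1.
  have x0 : 0 < T `^ (2 * a)^-1 by rewrite powR_gt0.
  have := @le_ln1Dx R (T `^ (2 * a)^-1 - 1).
  rewrite (addrC 1) subrK ln_powR ltrBrDr addNr => /(_ x0) H.
  rewrite -(ler_pM2l (_ : 0 < (2 * a)^-1)) ?invr_gt0 //.
  by rewrite mulrA mulVf ?gt_eqF // mul1r; lra.
have sqT : T `^ 2^-1 * T `^ 2^-1 = T.
  by rewrite powR12_sqrt ?ltW // -expr2 sqr_sqrtr // ltW.
have s0 : 0 < T `^ 2^-1 by rewrite powR_gt0.
have pow_le : logb T `^ a <= c * T `^ 2^-1.
  rewrite lT; apply: (@le_trans _ _ ((2 * a * T `^ (2 * a)^-1) `^ a)).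
    apply: ge0_ler_powR; rewrite ?nnegrE ?(ltW a0) //.
      by rewrite ln_ge0 //; lra.
    by rewrite mulr_ge0 ?powR_ge0 // ltW.
  rewrite powRM ?powR_ge0 ?(ltW a2) // -powRrM.
  suff -> : (2 * a)^-1 * a = 2^-1 by [].
  by rewrite invfM -mulrA mulVf ?mulr1 // gt_eqF.
have Td : T <= T ^+ d.
  by rewrite -{1}(expr1 T) ler_weXn2l //; lra.
apply: (@le_trans _ _ (C * (c * T `^ 2^-1 / T))).
  rewrite ler_pM2l //; apply: ler_pM; rewrite ?powR_ge0 ?invr_ge0 ?exprn_ge0 ?(ltW T0) //.
  by rewrite lef_pV2 ?posrE ?exprn_gt0.
have -> : C * (c * T `^ 2^-1 / T) = C * c / T `^ 2^-1.
  by rewrite -{2}sqT invfM mulrA; field; rewrite gt_eqF.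
rewrite ler_pdivrMr // [leRHS]mulrC -ler_pdivrMr //.
rewrite -(@ler_pXn2r _ 2) ?nnegrE ?(ltW s0) ?divr_ge0 ?mulr_ge0 ?(ltW C0) ?(ltW c0) ?(ltW e0) //.
by rewrite [leRHS]expr2 sqT; lra.
Qed.

Unset Implicit Arguments.

Theorem theorem1p1 (R : realType) (d k : nat) (d_gt0 : (0 < d)%N)
    (d_lt_k : (d < k)%N) (eps : R) (eps_gt0 : 0 < eps) :
  lebesgue_almost_all (fun L : 'M[R]_(k - d, d) =>
    totally_irrational L ->
    forall F : {vspace 'rV[R]_(d + (k - d))}, admissible L F ->
    exists2 C : R, 0 < C &
      forall s : 'rV[R]_(d + (k - d)), regular L F s ->
      forall r : R, 0 < r ->
      forall P : set 'rV[R]_(d + (k - d)), is_patch_class L F s r P ->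
      exists2 xiP : R, is_frequency L F r P xiP &
        forall y, cps L F s y -> forall T : R, 1 <= T ->
          `|xi L F s r P y T - xiP|
            <= C * (logb T `^ (k%:R + eps) / T ^+ d)).
Proof.
have m_gt0 : (0 < k - d)%N by rewrite subn_gt0.
apply: lebesgue_almost_all_imply (discrepancy_almost_all m_gt0 d_gt0 eps_gt0).
have kE : (d + (k - d))%:R = k%:R :> R by rewrite subnKC // ltnW.
move=> L [C C0 HC] _ F adm; rewrite kE in HC.
exists C => // s reg r r0 P [_ [z1 [_ hz1] <-] ->].
have [al [be [a0 ab b1 xiE]]] := xi_box_count adm (ltW r0) reg hz1.
pose vol := \prod_(j < k - d) (be j - al j).
(* Proved for every regular [s'], so that it yields both the error term and the convergence that
   makes [vol] the frequency. *)
have bound s' y T : regular L F s' -> cps L F s' y -> 1 <= T ->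
    `|xi L F s' r (patch_class L F s r (cproj L F z1)) y T - vol|
      <= C * (logb T `^ (k%:R + eps) / T ^+ d).
  move=> reg' [z [_ hz] <-] T1; have T0 : 0 <= T by lra.
  rewrite xiE //; set K := (2 * _ + 1)%N.
  (* For T >= 1 the side satisfies T <= K <= 3 T: the upper bound admits the discrepancy estimate,
     the lower one replaces K^d by T^d in the denominator. *)
  have /andP[N1] := truncn_itv T0; rewrite -natr1 => N2.
  have KE : K%:R = 2 * (Num.truncn T)%:R + 1 :> R by rewrite natrD natrM.
  have N0 : 0 <= (Num.truncn T)%:R :> R by [].
  have TK : T <= K%:R by lra.
  have K0 : 0 < K%:R ^+ d :> R by rewrite exprn_gt0 // KE; lra.
  have -> : forall x : R, x / K%:R ^+ d - vol = (x - K%:R ^+ d * vol) / K%:R ^+ d.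
    by move=> x; rewrite mulrBl mulrAC divff ?mul1r // gt_eqF.
  rewrite normrM (gtr0_norm (_ : 0 < _^-1)) ?invr_gt0 // mulrA.
  apply: ler_pM; rewrite ?invr_ge0 ?(ltW K0) //.
    by apply: HC => //; lra.
  by rewrite lef_pV2 ?posrE ?exprn_gt0 ?lerXn2r ?nnegrE //; lra.
exists vol; last by move=> y hy T; exact: bound.
move=> s' y reg' hy; apply/cvgrPdist_le => e e0.
have ke : 0 < k%:R + eps :> R by rewrite ltr_wpDl.
have [M M1 HM] := logb_powR_div_small d_gt0 ke C0 e0.
near=> T.
have MT : M <= T by near: T; apply: nbhs_pinfty_ge; exact: num_real.
rewrite distrC; apply: le_trans (bound _ _ _ reg' hy _) (HM T MT).
exact: le_trans MT.
Unshelve. all: by end_near.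
Qed.
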